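(* Let $d\geqslant 1$. There exists a constant $\kappa_d>0$, depending only on $d$, such that for every $\mu\in(0,1)$ and $\lambda>0$ which satisfy $$\kappa_d(2d\lambda)^\mu\ <\ \mu^\mu(1-\mu)^{1-\mu}\,,$$ the fixation time $\mathcal{T}_n$ of the Activated Random Walk model on the torus $\mathbb{Z}_n^d=(\mathbb{Z}/n\mathbb{Z})^d$ satisfies $$\exists\,c>0\,,\quad\forall\,n\geqslant 1\,,\qquad \mathbb{P}_\mu^\lambda\Big(\mathcal{T}_n<e^{cn^d}\Big)\ <\ e^{-cn^d}\,.$$
   Context: **Activated Random Walk (ARW) model on the torus with sleep rate $\lambda$.** The torus is $\mathbb{Z}_n^d=(\mathbb{Z}/n\mathbb{Z})^d$, in which the neighbours of $x$ are the $2d$ points $x\pm e_i$, $1\leqslant i\leqslant d$ (counted with multiplicity when $n\leqslant 2$). A configuration is a map $\eta:\mathbb{Z}_n^d\to\mathbb{N}\cup\{\mathfrak{s}\}$, where $\eta(x)=k\in\mathbb{N}=\{0,1,2,\dots\}$ means that there are $k$ active particles at $x$, and $\eta(x)=\mathfrak{s}$ means that there is exactly one sleeping particle at $x$. The model is a continuous-time Markov process $(\eta_t)_{t\geqslant 0}$: each active particle jumps at rate $1$, independently, to a uniformly chosen neighbour of its current site; each active particle which is alone on its site falls asleep at rate $\lambda$; a sleeping particle does not move, and as soon as an active particle arrives on its site it becomes active again (i.e. $\mathfrak{s}+1=2$). A configuration is *stable* if it contains no active particle, i.e. $\eta(x)\in\{0,\mathfrak{s}\}$ for all $x$. Stable configurations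 are absorbing. The fixation time is $\mathcal{T}_n=\inf\{t\geqslant 0:\eta_t\text{ is stable}\}\in[0,\infty]$. $\mathbb{P}_\mu^\lambda$ denotes the law of the ARW model on the torus with sleep rate $\lambda$ started from an initial configuration where the numbers of active particles on the sites are i.i.d. Poisson with mean $\mu$ and there are no sleeping particles. *)

(* Defs.v *)
From HB Require Import structures.
From mathcomp Require Import all_boot all_order all_algebra.
From mathcomp Require Import all_classical all_reals all_analysis.

Set Implicit Arguments.
Unset Strict Implicit.
Unset Printing Implicit Defensive.

Import Order.TTheory GRing.Theory Num.Theory.
Import numFieldNormedType.Exports.

Local Open Scope classical_set_scope.
Local Open Scope ring_scope.

Section MarkovProcess.
Context {R : realType} {S : countType}.

(* [L] is a Markov generator: if q(a, b) is the rate of the transition from a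
   to b, then L f a = \sum_b q(a, b) (f b - f a). In particular, applied at a to
   the indicator function of b, it gives q(a, b) if a != b, and minus the total
   rate of leaving a if a = b. *)
Implicit Types (L : (S -> R) -> S -> R) (p : R -> S -> S -> R).

(* The last clause reads p_h(a, b) = q(a, b) h + o(h) for a != b.
   [p t] is only meaningful for t >= 0. *)
Record transition_function L p : Prop := TransitionFunction {
  tf_ge0 : forall t a b, 0 <= t -> 0 <= p t a b ;
  tf_sum1 : forall t a, 0 <= t -> (\esum_(b in [set: S]) (p t a b)%:E = 1)%E ;
  tf_0 : forall a b, p 0 a b = (a == b)%:R ;
  tf_chapman_kolmogorov : forall s t a b, 0 <= s -> 0 <= t ->
    ((p (s + t) a b)%:E = \esum_(c in [set: S]) (p s a c * p t c b)%:E)%E ;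
  tf_rates : forall a b,
    h^-1 * (p h a b - (a == b)%:R) @[h --> 0^'+] --> L (fun c => (c == b)%:R) a
}.

(* [X t] is only meaningful for t >= 0. The paths are right-continuous for the
   discrete topology on S, and the last clause with m = 0 states that X_0 has
   law [nu]. *)
Record markov_process L (nu : S -> R) (dO : measure_display)
    (Omega : measurableType dO) (P : probability Omega R)
    (X : R -> Omega -> S) : Prop := MarkovProcess {
  mp_measurable : forall t a, 0 <= t -> measurable [set w | X t w = a] ;
  mp_right_continuous : forall w t, 0 <= t ->
    \forall s \near t^'+, X s w = X t w ;
  mp_law : exists2 p, transition_function L p &
    forall m (t : nat -> R) (a : nat -> S),
      t 0%N = 0 -> (forall i, t i <= t i.+1) ->
      P (\bigcap_(i in [set i : nat | (i <= m)%N]) [set w | X (t i) w = a i]) =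
      (nu (a 0%N) * \prod_(i < m) p (t i.+1 - t i) (a i) (a i.+1))%:E
}.

End MarkovProcess.

Section ActivatedRandomWalk.
Context {d n : nat}.

Definition torus : Type := {ffun 'I_d -> 'I_n}.
HB.instance Definition _ := Finite.on torus.

(* [ordS] and [ord_pred] are the cyclic successor and predecessor on 'I_n. *)
Definition torus_next (x : torus) (i : 'I_d) : torus :=
  [ffun j => if j == i then ordS (x j) else x j].
Definition torus_prev (x : torus) (i : 'I_d) : torus :=
  [ffun j => if j == i then ord_pred (x j) else x j].

(* [Some k] stands for k active particles, [None] for one sleeping particle. *)
Definition config : Type := {ffun torus -> option nat}.
HB.instance Definition _ := Countable.on config.

Implicit Types (eta : config) (x y : torus).

Definition nb_active eta x : nat := if eta x is Some k then k else 0.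

Definition stable eta : Prop := forall x, nb_active eta x = 0%N.

Definition remove_active eta x : config :=
  [ffun z => if z == x then Some (nb_active eta x).-1 else eta z].

(* s + 1 = 2 *)
Definition add_active eta y : config :=
  [ffun z => if z == y then Some (if eta y is Some k then k.+1 else 2%N)
             else eta z].

(* Removing before adding gives the right result also when y = x, which
   happens when n = 1. *)
Definition jump eta x y : config := add_active (remove_active eta x) y.

Definition fall_asleep eta x : config :=
  [ffun z => if z == x then None else eta z].

Context {R : realType}.

Definition arw_generator (lambda : R) (f : config -> R) eta : R :=
  \sum_x (nb_active eta x)%:R *
    (\sum_(i < d) (2 * d%:R)^-1 *
       ((f (jump eta x (torus_next x i)) - f eta) +
        (f (jump eta x (torus_prev x i)) - f eta)))
  + \sum_(x | eta x == Some 1%N) lambda * (f (fall_asleep eta x) - f eta).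

(* The numbers of active particles are i.i.d. Poisson with mean [mu], and no
   particle is sleeping. *)
Definition arw_initial_law (mu : R) eta : R :=
  \prod_x (if eta x is Some k then poisson_pmf mu k else 0).

Definition arw (mu lambda : R) (dO : measure_display)
    (Omega : measurableType dO) (P : probability Omega R)
    (X : R -> Omega -> config) : Prop :=
  markov_process (arw_generator lambda) (arw_initial_law mu) P X.

(* The infimum of the empty set is +oo. *)
Definition fixation_time (Omega : Type) (X : R -> Omega -> config) (w : Omega)
    : \bar R :=
  ereal_inf [set t%:E | t in [set t : R | 0 <= t /\ stable (X t w)]].

End ActivatedRandomWalk.

Arguments torus : clear implicits.
Arguments config : clear implicits.

(* Main.v *)
Require Import Defs.
From mathcomp Require Import all_boot all_order all_algebra.
From mathcomp Require Import all_classical all_reals all_analysis.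
From mathcomp Require Import ring lra zify.

Set Implicit Arguments.
Unset Strict Implicit.
Unset Printing Implicit Defensive.

Import Order.TTheory GRing.Theory Num.Theory.
Import numFieldNormedType.Exports.

Local Open Scope classical_set_scope.
Local Open Scope ring_scope.

(** Write [V = n ^ d] for the volume and [N] for the number of particles, which is
    conserved. If [N > V] the process never stabilises. Otherwise its final
    configuration is [asleep A] for a set [A] of [N] sites, and as there are at
    most [2 ^ V] such sets, it is enough to bound the probability of stabilising
    in each of them by [(2 * lambda) ^ N] times a factor exponential in [V].

    The Abelian property reduces the continuous-time process to topplings in an
    order that can be chosen at will. Let [settle phi M eta] be the expectation of
    [phi] at the final configuration on the event that [M] topplings suffice to
    stabilise [eta]. As topplings of distinct sites commute, the equation
    [settle_topple] holds for all active sites at once, so that the generator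
    maps [settle phi M] to a multiple of [settle phi M.+1 - settle phi M]. The
    average of [settle 1 i] over [i < M] is then a nearly harmonic function, equal
    to [1] at stable configurations, whose drift is [O(V / M)]. Hence the
    probability of being stable at time [t] is at most
    [settle 1 M eta + O(V t / M)] (lemmas [transition_drift] and
    [unstable_transition]). Take [M] and [t] exponential in [V].

    To bound [settle (dormant A) M eta], sleep instructions are ignored where they
    do not help to reach [asleep A], and the particles are first moved until each
    site of [A] has one particle. From then on, a toppled particle makes an
    excursion from its site [x] back to it, wakes up the particles it meets, and falls
    asleep with probability [lambda / (1 + lambda)] at each visit of [x]. Lemma
    [settle_le_potential] turns any function of the set of sleeping sites that
    decreases on average for one choice of [x], up to an excess [Theta] at each
    toppling, into a bound of order [M * Theta].

    Such a function is built by merging clusters of sites of [A], starting from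
    singletons, for which the excess is [lambda]. Two clusters between which an
    excursion succeeds with probability [rho] have a combined potential whose
    excess is the product of their excesses, up to a factor [O(rho ^ -2)]
    ([potential_merge]); if [rho] is too small for that, then one of the clusters
    has a large excess, and it is given up at a cost of the same order. By the
    pigeonhole principle, when [k] clusters are left, two of them are at distance
    [O((V / k) ^ (1 / d))], and then [1 / rho <= exp (O(sqrt (V / k)))]: in
    dimension one [rho] is the ruin probability of a symmetric gambler, and in
    higher dimensions it is at least exponentially small in the distance. Since
    [\sum_(k <= V) sqrt (V / k) = O(V)], all the mergers cost a factor [exp (O(V))]
    ([settle_dormant_le]).

    Finally the Poisson variable [N] is averaged out: a bound [exp y], with [y]
    affine in [N] and [V], on a probability implies the bound [exp (s * y)] for
    all [0 <= s <= 1], and for small [s] the average of the latter is governed by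
    the value of [y] at [N = mu * V], which is negative by assumption. *)

(** * Topplings and the Abelian property *)

Section Toppling.
Context {R : realType} {d n : nat}.
Hypothesis d_gt0 : (0 < d)%N.
Implicit Types (f g : torus d n -> R) (x y z : torus d n) (eta : config d n).

Definition nbr_avg f x : R :=
  \sum_(i < d) (2 * d%:R)^-1 * (f (torus_next x i) + f (torus_prev x i)).

Let d2_gt0 : 0 < 2 * d%:R :> R.
Proof. by rewrite mulr_gt0 // ltr0n. Qed.

Lemma nbr_avg_cst (c : R) x : nbr_avg (fun=> c) x = c.
Proof.
rewrite /nbr_avg sumr_const card_ord -mulr_natl; field.
by rewrite pnatr_eq0 -lt0n.
Qed.

Lemma nbr_avgD f g x : nbr_avg (fun y => f y + g y) x = nbr_avg f x + nbr_avg g x.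
Proof. by rewrite /nbr_avg -big_split/=; apply: eq_bigr => i _; ring. Qed.

Lemma nbr_avgZ (c : R) f x : nbr_avg (fun y => c * f y) x = c * nbr_avg f x.
Proof. by rewrite /nbr_avg mulr_sumr; apply: eq_bigr => i _; ring. Qed.

Lemma nbr_avgB f g x : nbr_avg (fun y => f y - g y) x = nbr_avg f x - nbr_avg g x.
Proof. by rewrite /nbr_avg -sumrB; apply: eq_bigr => i _; ring. Qed.

Lemma nbr_avg_sum (I : Type) (r : seq I) (F : I -> torus d n -> R) x :
  nbr_avg (fun y => \sum_(i <- r) F i y) x = \sum_(i <- r) nbr_avg (F i) x.
Proof.
rewrite /nbr_avg exchange_big/=; apply: eq_bigr => i _.
by rewrite -big_split/= mulr_sumr.
Qed.

Lemma eq_nbr_avg f g x : f =1 g -> nbr_avg f x = nbr_avg g x.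
Proof. by move=> fg; apply: eq_bigr => i _; rewrite !fg. Qed.

Lemma nbr_avg_le f g x : (forall y, f y <= g y) -> nbr_avg f x <= nbr_avg g x.
Proof.
move=> fg; apply: ler_sum => i _; rewrite ler_pM2l ?invr_gt0//.
exact: lerD.
Qed.

Lemma nbr_avg_exchange (F : torus d n -> torus d n -> R) x y :
  nbr_avg (fun z => nbr_avg (F z) y) x = nbr_avg (fun w => nbr_avg (F^~ w) x) y.
Proof.
rewrite /nbr_avg.
under eq_bigr do rewrite -big_split mulr_sumr.
under [RHS]eq_bigr do rewrite -big_split mulr_sumr.
rewrite exchange_big/=; apply: eq_bigr => i _; apply: eq_bigr => j _; ring.
Qed.

Lemma nbr_avg_ge_nbr f x (i : 'I_d) (b : bool) (u c : R) :
  u <= f (if b then torus_next x i else torus_prev x i) -> (forall y, c <= f y) ->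
  (2 * d%:R)^-1 * u + (1 - (2 * d%:R)^-1) * c <= nbr_avg f x.
Proof.
move=> fi fc.
have -> : (2 * d%:R)^-1 * u + (1 - (2 * d%:R)^-1) * c =
    (2 * d%:R)^-1 * (u - c) + c by ring.
rewrite -lerBrDr -{2}(nbr_avg_cst c x) -nbr_avgB /nbr_avg (bigD1 i)//=.
rewrite -[leLHS]addr0; apply: lerD.
  rewrite ler_pM2l ?invr_gt0//.
  have := fc (torus_next x i); have := fc (torus_prev x i).
  by case: b fi; lra.
apply: sumr_ge0 => j _; apply: mulr_ge0; first by rewrite invr_ge0 ltW.
by rewrite addr_ge0// subr_ge0.
Qed.

(** A sleep instruction at [x], in the site-wise representation of the model. *)
Definition doze eta x : config d n :=
  if eta x == Some 1%N then fall_asleep eta x else eta.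

Definition active eta x : bool := (0 < nb_active eta x)%N.

(** In the site-wise representation, each instruction at [x] is a jump with
    probability [1/(1+lambda)] and a sleep instruction otherwise. *)
Definition topple (lambda : R) (phi : config d n -> R) x eta : R :=
  (1 + lambda)^-1 * (nbr_avg (fun y => phi (jump eta x y)) x
                     + lambda * phi (doze eta x)).

Lemma activeE eta x : active eta x = (eta x != None) && (eta x != Some 0%N).
Proof. by rewrite /active /nb_active; case: (eta x) => [[|k]|]. Qed.

Lemma add_activeE eta y z :
  add_active eta y z = if z == y then Some (if eta z is Some k then k.+1 else 2%N)
                       else eta z.
Proof. by rewrite ffunE; case: eqVneq => [->|]. Qed.

Lemma jumpE eta x y z : jump eta x y z =
  if z == y
  then Some (if z == x then (nb_active eta z).-1.+1
             else if eta z is Some k then k.+1 else 2%N)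
  else if z == x then Some (nb_active eta z).-1 else eta z.
Proof. by rewrite add_activeE !ffunE; have [->|] := eqVneq z x. Qed.

Lemma active_jump eta x y z : x != y -> active eta y -> active (jump eta x z) y.
Proof.
move=> xy; rewrite /active /nb_active jumpE (eq_sym y x) (negPf xy).
by case: (y == z); case: (eta y).
Qed.

Lemma active_doze eta x y : x != y -> active eta y -> active (doze eta x) y.
Proof.
move=> xy; rewrite /doze /active /nb_active; case: ifP => // _.
by rewrite /fall_asleep ffunE (eq_sym y x) (negPf xy).
Qed.

Lemma jumpC eta x y z w : x != y -> active eta x -> active eta y ->
  jump (jump eta x z) y w = jump (jump eta y w) x z.
Proof.
move=> xy; rewrite !activeE => /andP[xN x0] /andP[yN y0]; apply/ffunP => t.
rewrite !jumpE /nb_active !jumpE /nb_active.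
have yx : (y == x) = false by rewrite eq_sym (negPf xy).
have [->|tx] := eqVneq t x; first rewrite (negPf xy); last first.
  have [->|ty] := eqVneq t y; last first.
    by case: (t == z); case: (t == w); case: (eta t).
  by case: (eta y) yN y0 => [[|k]|]//=; case: (y == z); case: (y == w).
by case: (eta x) xN x0 => [[|k]|]//=; case: (x == z); case: (x == w).
Qed.

Lemma doze_jumpC eta x y z : x != y -> active eta x -> active eta y ->
  doze (jump eta x z) y = jump (doze eta y) x z.
Proof.
move=> xy; rewrite !activeE => /andP[xN x0] /andP[yN y0].
have yx : (y == x) = false by rewrite eq_sym (negPf xy).
rewrite /doze jumpE yx; have [yz|yz] := eqVneq y z; last first.
  case: ifP => // y1; apply/ffunP => t; rewrite ffunE !jumpE /nb_active !ffunE.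
  have [->|ty] := eqVneq t y; last by [].
  by rewrite (negPf yz) yx.
rewrite -yz ifN; last by case: (eta y) yN y0 => [[|k]|].
case: ifP => // /eqP y1; apply/ffunP => t; rewrite !jumpE /nb_active !ffunE.
by have [->|ty] := eqVneq t y; rewrite // yx y1.
Qed.

Lemma dozeC eta x y : x != y -> doze (doze eta x) y = doze (doze eta y) x.
Proof.
move=> xy; rewrite /doze.
have [x1|x1] := eqVneq (eta x) (Some 1%N); have [y1|y1] := eqVneq (eta y) (Some 1%N);
  rewrite ?ffunE ?(eq_sym y x) ?(negPf xy) ?x1 ?y1 ?eqxx ?(negPf x1) ?(negPf y1) //.
by apply/ffunP => t; rewrite !ffunE; case: eqVneq; case: eqVneq.
Qed.

Section Topple.
Variable lambda : R.
Hypothesis lambda_gt0 : 0 < lambda.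
Implicit Types phi psi : config d n -> R.

Let lam1 : 0 < 1 + lambda. Proof. by rewrite addr_gt0. Qed.

Lemma toppleC phi x y eta : x != y -> active eta x -> active eta y ->
  topple lambda (topple lambda phi y) x eta = topple lambda (topple lambda phi x) y eta.
Proof.
move=> xy ax ay; have yx : y != x by rewrite eq_sym.
rewrite /topple.
have EA u v (A : torus d n -> torus d n -> R) (B : torus d n -> R) :
    nbr_avg (fun z => (1 + lambda)^-1 * (nbr_avg (A z) v + lambda * B z)) u =
    (1 + lambda)^-1 * (nbr_avg (fun z => nbr_avg (A z) v) u + lambda * nbr_avg B u).
  by rewrite nbr_avgZ nbr_avgD nbr_avgZ.
rewrite !EA; congr (_ * _).
rewrite nbr_avg_exchange.
have -> : nbr_avg (fun w => nbr_avg (fun z => phi (jump (jump eta x z) y w)) x) y =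
    nbr_avg (fun w => nbr_avg (fun z => phi (jump (jump eta y w) x z)) x) y.
  by apply: eq_nbr_avg => w; apply: eq_nbr_avg => z; rewrite jumpC.
have -> : nbr_avg (fun z => phi (doze (jump eta x z) y)) x =
    nbr_avg (fun z => phi (jump (doze eta y) x z)) x.
  by apply: eq_nbr_avg => z; rewrite doze_jumpC.
have -> : nbr_avg (fun z => phi (doze (jump eta y z) x)) y =
    nbr_avg (fun z => phi (jump (doze eta x) y z)) y.
  by apply: eq_nbr_avg => z; rewrite doze_jumpC.
rewrite dozeC//; ring.
Qed.

Lemma eq_topple phi psi x eta : (forall y, phi (jump eta x y) = psi (jump eta x y)) ->
  phi (doze eta x) = psi (doze eta x) -> topple lambda phi x eta = topple lambda psi x eta.
Proof. by move=> j s; rewrite /topple s; congr (_ * (_ + _)); apply: eq_nbr_avg. Qed.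

Lemma topple_le phi psi x eta : (forall y, phi (jump eta x y) <= psi (jump eta x y)) ->
  phi (doze eta x) <= psi (doze eta x) -> topple lambda phi x eta <= topple lambda psi x eta.
Proof.
move=> j s; rewrite ler_pM2l ?invr_gt0//; apply: lerD; first exact: nbr_avg_le.
by rewrite ler_pM2l.
Qed.

Lemma topple_cst (c : R) x eta : topple lambda (fun=> c) x eta = c.
Proof. by rewrite /topple nbr_avg_cst; field; rewrite gt_eqF. Qed.

Lemma topple_sum (I : Type) (r : seq I) (F : I -> config d n -> R) x eta :
  topple lambda (fun e => \sum_(i <- r) F i e) x eta =
  \sum_(i <- r) topple lambda (F i) x eta.
Proof.
rewrite /topple nbr_avg_sum mulr_sumr -big_split/= mulr_sumr.
by apply: eq_bigr => i _.
Qed.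

(** The expectation of [phi] at the final configuration, on the event that
    [M] topplings suffice to stabilise, when the sites are toppled in an order
    fixed once and for all. *)
Fixpoint settle phi (M : nat) eta : R :=
  match M, [pick x | active eta x] with
  | _, None => phi eta
  | 0%N, Some _ => 0
  | M'.+1, Some x => topple lambda (settle phi M') x eta
  end.

Lemma settle_stable phi M eta : (forall x, ~~ active eta x) -> settle phi M eta = phi eta.
Proof. by move=> st; case: M => [|M] /=; case: pickP => // x ax; rewrite (negPf (st x)) in ax. Qed.

Lemma settle0 phi eta x : active eta x -> settle phi 0 eta = 0.
Proof. by move=> ax /=; case: pickP => // /(_ x); rewrite ax. Qed.

(** The Abelian property: as topplings of distinct sites commute, the choice of
    the next site to be toppled is irrelevant. *)
Lemma settle_topple phi M eta x : active eta x ->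
  settle phi M.+1 eta = topple lambda (settle phi M) x eta.
Proof.
have settleS M' e : settle phi M'.+1 e =
    if [pick x | active e x] is Some x then topple lambda (settle phi M') x e
    else phi e by [].
elim: M eta x => [|M IH] eta x ax; rewrite settleS.
  case: pickP => [x0 ax0|/(_ x)]; last by rewrite ax.
  have [->//|xx0] := eqVneq x x0.
  rewrite (@eq_topple _ (fun=> 0)) 1?(@eq_topple (settle phi 0) (fun=> 0) x) //.
  - by move=> y; rewrite (@settle0 _ _ x0)// active_jump.
  - by rewrite (@settle0 _ _ x0)// active_doze.
  - by move=> y; rewrite (@settle0 _ _ x)// active_jump// eq_sym.
  - by rewrite (@settle0 _ _ x)// active_doze// eq_sym.
case: pickP => [x0 ax0|/(_ x)]; last by rewrite ax.
have [->//|xx0] := eqVneq x x0; have x0x : x0 != x by rewrite eq_sym.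
transitivity (topple lambda (topple lambda (settle phi M) x) x0 eta).
  by apply: eq_topple => [y|]; apply: IH; [exact: active_jump|exact: active_doze].
rewrite toppleC//.
by apply: eq_topple => [y|]; symmetry; apply: IH; [exact: active_jump|exact: active_doze].
Qed.

Lemma stable_dec eta : (exists x, active eta x) \/ (forall x, ~~ active eta x).
Proof.
case: (pickP (active eta)) => [x ax|h]; first by left; exists x.
by right => x; rewrite h.
Qed.

Lemma settle_ge0 phi M eta : (forall e, 0 <= phi e) -> 0 <= settle phi M eta.
Proof.
move=> phi0; elim: M eta => [|M IH] eta; have [[x ax]|st] := stable_dec eta.
- by rewrite (settle0 _ ax).
- by rewrite settle_stable.
- rewrite (settle_topple _ _ ax) -(topple_cst 0 x eta).
  exact: topple_le.
- by rewrite settle_stable.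
Qed.

Lemma settle_le1 phi M eta : (forall e, phi e <= 1) -> settle phi M eta <= 1.
Proof.
move=> phi1; elim: M eta => [|M IH] eta; have [[x ax]|st] := stable_dec eta.
- by rewrite (settle0 _ ax).
- by rewrite settle_stable.
- rewrite (settle_topple _ _ ax) -(topple_cst 1 x eta).
  exact: topple_le.
- by rewrite settle_stable.
Qed.

Lemma settle_leS phi M eta : (forall e, 0 <= phi e) ->
  settle phi M eta <= settle phi M.+1 eta.
Proof.
move=> phi0; elim: M eta => [|M IH] eta; have [[x ax]|st] := stable_dec eta.
- by rewrite (settle0 _ ax) settle_ge0.
- by rewrite !settle_stable.
- by rewrite (settle_topple _ _ ax) (settle_topple _ M.+1 ax); exact: topple_le.
- by rewrite !settle_stable.
Qed.

Lemma settle_sum (I : Type) (r : seq I) (F : I -> config d n -> R) M eta :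
  settle (fun e => \sum_(i <- r) F i e) M eta = \sum_(i <- r) settle (F i) M eta.
Proof.
elim: M eta => [|M IH] eta; have [[x ax]|st] := stable_dec eta.
- by rewrite (settle0 _ ax) big1// => i _; rewrite (settle0 _ ax).
- by rewrite settle_stable//; apply: eq_bigr => i _; rewrite settle_stable.
- rewrite (settle_topple _ _ ax) (@eq_topple _ (fun e => \sum_(i <- r) settle (F i) M e))//.
  by rewrite topple_sum; apply: eq_bigr => i _; rewrite (settle_topple _ _ ax).
- by rewrite settle_stable//; apply: eq_bigr => i _; rewrite settle_stable.
Qed.

(** In continuous time, a site with [k] active particles is toppled at rate
    [k (1 + lambda)]: if [k >= 2], the sleep instructions change nothing. *)
Lemma arw_generatorE phi eta :
  arw_generator lambda phi eta =
  \sum_(x | active eta x) (nb_active eta x)%:R * (1 + lambda) * (topple lambda phi x eta - phi eta).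
Proof.
rewrite /arw_generator [X in X + _](bigID (active eta))/= [X in _ + X + _]big1 ?addr0; last first.
  by move=> x; rewrite /active -eqn0Ngt => /eqP->; rewrite mul0r.
rewrite [X in _ + X](bigID (active eta))/= [X in _ + (_ + X)]big1 ?addr0; last first.
  by move=> x /andP[/eqP ex]; rewrite /active /nb_active ex.
rewrite [X in _ + X]big_mkcondl -big_split/=; apply: eq_bigr => x ax.
have -> : \sum_(i < d) (2 * d%:R)^-1 *
       ((phi (jump eta x (torus_next x i)) - phi eta) +
        (phi (jump eta x (torus_prev x i)) - phi eta)) =
    nbr_avg (fun y => phi (jump eta x y)) x - phi eta.
  by rewrite -{3}(nbr_avg_cst (phi eta) x) -nbr_avgB.
rewrite /topple /doze; have [x1|x1] := eqVneq (eta x) (Some 1%N).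
  have -> : nb_active eta x = 1%N by rewrite /nb_active x1.
  by field; rewrite gt_eqF.
by field; rewrite gt_eqF.
Qed.

Lemma generator_settle phi M eta :
  arw_generator lambda (settle phi M) eta =
  (\sum_(x | active eta x) (nb_active eta x)%:R * (1 + lambda)) *
  (settle phi M.+1 eta - settle phi M eta).
Proof.
rewrite arw_generatorE mulr_suml; apply: eq_bigr => x ax.
by rewrite -(settle_topple _ _ ax).
Qed.

End Topple.

End Toppling.

(** * Reaching a prescribed stable configuration *)

Section Target.
Context {R : realType} {d n : nat}.
Hypothesis d_gt0 : (0 < d)%N.
Variable lambda : R.
Hypothesis lambda_gt0 : 0 < lambda.
Implicit Types (x y z : torus d n) (eta xi : config d n) (A S : {set torus d n}).

Let lam1 : 0 < 1 + lambda. Proof. by rewrite addr_gt0. Qed.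

Definition asleep A : config d n := [ffun x => if x \in A then None else Some 0%N].

Definition dormant A eta : R := (eta == asleep A)%:R.

Definition sleepers eta : {set torus d n} := [set x | eta x == None]%SET.

Definition npart eta : nat := \sum_x (if eta x is Some k then k else 1%N).

Lemma dormant_ge0 A eta : 0 <= dormant A eta.
Proof. exact: ler0n. Qed.

Lemma npart_add eta x : npart (add_active eta x) = (npart eta).+1.
Proof.
rewrite /npart (bigD1 x)//= [in RHS](bigD1 x)//= add_activeE eqxx.
under eq_bigr do rewrite add_activeE.
rewrite (eq_bigr (fun y => if eta y is Some k then k else 1%N)).
  by case: (eta x) => [k|]; rewrite addSn.
by move=> y /negPf->.
Qed.

Lemma npart_remove eta x : active eta x -> (npart (remove_active eta x)).+1 = npart eta.
Proof.
move=> ax; rewrite /npart (bigD1 x)//= [in RHS](bigD1 x)//= ffunE eqxx.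
rewrite (eq_bigr (fun y => if eta y is Some k then k else 1%N)); last first.
  by move=> y /negPf yx; rewrite ffunE yx.
by move: ax; rewrite -addSn /active /nb_active; case: (eta x) => [[|k]|].
Qed.

Lemma npart_jump eta x y : active eta x -> npart (jump eta x y) = npart eta.
Proof. by move=> ax; rewrite npart_add npart_remove. Qed.

Lemma npart_doze eta x : npart (doze eta x) = npart eta.
Proof.
rewrite /doze; case: eqVneq => // x1; apply: eq_bigr => y _; rewrite ffunE.
by case: eqVneq => // ->; rewrite x1.
Qed.

Lemma sleepers_add eta x : sleepers (add_active eta x) = (sleepers eta :\ x)%SET.
Proof. by apply/setP => y; rewrite !inE add_activeE; case: (eqVneq y x). Qed.

Lemma sleepers_remove eta x : active eta x -> sleepers (remove_active eta x) = sleepers eta.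
Proof.
rewrite activeE => /andP[xN _]; apply/setP => y; rewrite !inE ffunE.
by case: (eqVneq y x) => // ->; rewrite (negPf xN).
Qed.

Lemma sleepers_jump eta x y : active eta x -> sleepers (jump eta x y) = (sleepers eta :\ y)%SET.
Proof. by move=> ax; rewrite sleepers_add sleepers_remove. Qed.

Lemma sleepers_fall_asleep eta x : sleepers (fall_asleep eta x) = (x |: sleepers eta)%SET.
Proof. by apply/setP => y; rewrite !inE ffunE; case: (eqVneq y x). Qed.

Lemma active_add eta x : active (add_active eta x) x.
Proof. by rewrite /active /nb_active add_activeE eqxx; case: (eta x). Qed.

(** A particle which sleeps outside [A] has to be woken up by another particle
    before [asleep A] is reached, and the topplings made until then can be
    made as well if it is active. *)
Lemma settle_wake A M eta x : x \notin A -> eta x = Some 1%N ->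
  settle lambda (dormant A) M (fall_asleep eta x) <= settle lambda (dormant A) M eta.
Proof.
move=> xA; elim: M eta => [|M IH] eta x1.
all: have [[y ay]|st] := stable_dec (fall_asleep eta x); last first.
all: try by [rewrite settle_stable// /dormant; case: eqVneq => [e|_];
  [move: (congr1 (fun e : config d n => e x) e); rewrite !ffunE eqxx (negPf xA)
  |exact: settle_ge0]].
  by rewrite (settle0 _ _ ay); exact: settle_ge0.
have yx : y != x.
  by apply: contraL ay => /eqP->; rewrite /active /nb_active ffunE eqxx.
have xy : x != y by rewrite eq_sym.
have ey : fall_asleep eta x y = eta y by rewrite ffunE (negPf yx).
have ay' : active eta y by move: ay; rewrite /active /nb_active ey.
rewrite (settle_topple _ _ _ ay) (settle_topple _ _ _ ay').
rewrite /topple ler_pM2l ?invr_gt0//; apply: lerD.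
  apply: nbr_avg_le => // z; have [->|zx] := eqVneq z x.
    rewrite (_ : jump _ _ _ = jump eta y x)//; apply/ffunP => t.
    rewrite !jumpE /nb_active !ffunE.
    by have [->|//] := eqVneq t x; rewrite (negPf xy) x1.
  rewrite (_ : jump _ _ _ = fall_asleep (jump eta y z) x).
    by apply: IH; rewrite jumpE eq_sym (negPf zx) (negPf xy).
  apply/ffunP => t; rewrite [RHS]ffunE !jumpE /nb_active !ffunE.
  by have [->|//] := eqVneq t x; rewrite eq_sym (negPf zx) (negPf xy).
rewrite ler_pM2l// {1}/doze ey /doze; case: eqVneq => [y1|]; last by rewrite IH.
rewrite (_ : fall_asleep _ _ = fall_asleep (fall_asleep eta y) x).
  by apply: IH; rewrite ffunE (negPf xy).
apply/ffunP => t; rewrite !ffunE.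
by case: eqVneq; case: eqVneq.
Qed.

(** Sleep instructions may be ignored at a site where they do not help to reach
    [asleep A]. *)
Lemma settle_ignore_sleep A M eta x : active eta x ->
  (x \notin A) || (2 <= nb_active eta x)%N ->
  settle lambda (dormant A) M.+1 eta <=
  nbr_avg (fun y => settle lambda (dormant A) M (jump eta x y)) x.
Proof.
move=> ax ov; have := settle_topple lambda (dormant A) M ax.
rewrite /topple => e.
have {e} : (1 + lambda) * settle lambda (dormant A) M.+1 eta =
    nbr_avg (fun y => settle lambda (dormant A) M (jump eta x y)) x +
    lambda * settle lambda (dormant A) M (doze eta x).
  by rewrite e mulrA divff ?mul1r// gt_eqF.
have : settle lambda (dormant A) M (doze eta x) <= settle lambda (dormant A) M.+1 eta.
  apply: le_trans (settle_leS d_gt0 lambda_gt0 M eta (@dormant_ge0 A)).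
  rewrite /doze; case: eqVneq => // x1; apply: settle_wake => //.
  by case/orP: ov => //; rewrite /nb_active x1.
rewrite -(ler_pM2l lambda_gt0).
lra.
Qed.

(** A walk started at [x] visits [y] before it returns to [x] with probability
    at least [rho]; the witness [v] stands for the probability of visiting [y]
    before [x], seen from the current position of the walk. *)
Definition escape x y (rho : R) : Prop := exists2 v : torus d n -> R,
  [/\ forall z, 0 <= v z <= 1, v x = 0 &
      forall z, z != x -> z != y -> v z <= nbr_avg v z] & rho <= nbr_avg v x.

Section Potential.
Variables (A : {set torus d n}) (f : {set torus d n} -> R) (Theta : R).
Hypothesis f_ge0 : forall S, 0 <= f S.
Hypothesis f_mono : forall S S', S \subset S' -> f S <= f S'.
Hypothesis fA : 1 <= f A.
Hypothesis Theta_ge0 : 0 <= Theta.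
Hypothesis f_step : forall S, S \proper A -> exists x y rho,
  [/\ x \in A, x \notin S, escape x y rho &
    lambda * (f (x |: S)%SET - f S) <= rho * (f S - f (S :\ y)%SET) + Theta].

Lemma npart_full eta : npart eta = #|A| -> sleepers eta \subset A ->
  (forall x, active eta x -> (x \in A) && (nb_active eta x == 1%N)) ->
  forall x, eta x = if x \in A then (if x \in sleepers eta then None else Some 1%N)
                    else Some 0%N.
Proof.
move=> eN /fintype.subsetP sA home.
have out y : y \notin A -> eta y = Some 0%N.
  move=> yA; case ey : (eta y) => [[//|k]|].
    have /home : active eta y by rewrite activeE ey.
    by rewrite (negPf yA).
  have : y \in sleepers eta by rewrite inE ey.
  by move/sA; rewrite (negPf yA).
have in1 y : ((if eta y is Some k then k else 1%N) <= (y \in A))%N.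
  case: (boolP (y \in A)) => [yA|/out->//].
  case ey : (eta y) => [[//|k]|//].
  have /home : active eta y by rewrite activeE ey.
  by rewrite /nb_active ey => /andP[_ /eqP[->]].
have full y : y \in A -> (if eta y is Some k then k else 1%N) = 1%N.
  move=> yA; apply/eqP; move: (in1 y); rewrite yA leq_eqVlt => /orP[//|lt1].
  have : (npart eta < \sum_y (y \in A))%N.
    rewrite /npart (bigD1 y)//= [X in (_ < X)%N](bigD1 y)//= yA.
    by rewrite -addSn leq_add// leq_sum.
  rewrite eN -sum1_card [X in (X < _)%N]big_mkcond/=.
  by rewrite (eq_bigr (fun y => nat_of_bool (y \in A))) ?ltnn// => z _; case: ifP.
move=> y; case: ifPn => [yA|/out//]; rewrite inE.
by move: (full _ yA); case: (eta y) => // k ->.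
Qed.

(** All the particles but one sit on [A], at most one of which is vacant, and
    the last one, at [z], walks; the bound interpolates between the potential
    before and after the site [y] is woken up. Since [f] is monotone, waking
    other sites up along the way does no harm. *)
Let walk_bound M := forall x y v xi z,
  (forall z, 0 <= v z <= 1) -> v x = 0 ->
  (forall z, z != x -> z != y -> v z <= nbr_avg v z) ->
  (npart xi).+1 = #|A| -> sleepers xi \subset A ->
  (forall a, a \in A -> a != x -> xi a != Some 0%N) ->
  settle lambda (dormant A) M (add_active xi z) <=
  (1 - v z) * f (sleepers (add_active xi z)) +
  v z * f (sleepers (add_active xi z) :\ y)%SET + M%:R * Theta.

Let home_bound M := forall eta, npart eta = #|A| -> sleepers eta \subset A ->
  settle lambda (dormant A) M eta <= f (sleepers eta) + M%:R * Theta.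

Let home_step M : home_bound M -> walk_bound M -> home_bound M.+1.
Proof.
move=> hM wM eta eN eA.
have fS y : f (sleepers eta :\ y)%SET <= f (sleepers eta) by apply/f_mono/finset.subD1set.
have MT : M%:R * Theta <= M.+1%:R * Theta.
  by rewrite ler_wpM2r// ler_nat.
have [/existsP[x /andP[ax ov]]|/existsPn home] :=
    boolP [exists x, active eta x && ((x \notin A) || (2 <= nb_active eta x)%N)].
  apply: le_trans (settle_ignore_sleep _ ax ov) _.
  apply: le_trans (_ : nbr_avg (fun=> f (sleepers eta) + M%:R * Theta) x <= _); last first.
    by rewrite nbr_avg_cst// lerD2l.
  apply: nbr_avg_le => // y.
  have := hM (jump eta x y); rewrite npart_jump// sleepers_jump//.
  move=> /(_ eN (fintype.subset_trans (finset.subD1set _ _) eA)) h.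
  by apply: le_trans h _; rewrite lerD2r.
have ac1 x : active eta x -> (x \in A) && (nb_active eta x == 1%N).
  move=> ax; move: (home x); rewrite ax negb_or negbK -ltnNge ltnS => /andP[-> le1].
  by rewrite eqn_leq le1.
have etaE := npart_full eN eA ac1.
have [SA|] := eqVneq (sleepers eta) A.
  rewrite SA; apply: le_trans (_ : 1 <= _).
    by apply: settle_le1 => // e; rewrite /dormant; case: eqP.
  by rewrite -[leLHS]addr0 lerD// mulr_ge0.
move=> SnA; have SpA : sleepers eta \proper A by rewrite finset.properEneq SnA.
have [x [y [rho [xA xS [v [v01 vx vsub] rhov] st]]]] := f_step SpA.
have x1 : eta x = Some 1%N by rewrite etaE xA (negPf xS).
have ax : active eta x by rewrite activeE x1.
rewrite (settle_topple _ _ _ ax) /topple.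
set g := fun z => (1 - v z) * f (sleepers eta) + v z * f (sleepers eta :\ y)%SET + M%:R * Theta.
have jumps : nbr_avg (fun z => settle lambda (dormant A) M (jump eta x z)) x <= nbr_avg g x.
  apply: nbr_avg_le => // z; rewrite /jump.
  have := wM x y v (remove_active eta x) z v01 vx vsub.
  rewrite npart_remove// sleepers_add sleepers_remove// => /(_ eN eA) h.
  apply: le_trans (h _) _.
    move=> a aA ax'; rewrite ffunE (negPf ax') etaE aA.
    by case: ifP.
  have /andP[v0 v1] := v01 z.
  rewrite /g lerD2r lerD//; apply: ler_wpM2l => //; first by rewrite subr_ge0.
  by apply/f_mono/finset.setSD/finset.subD1set.
have gE : nbr_avg g x = f (sleepers eta)
    - nbr_avg v x * (f (sleepers eta) - f (sleepers eta :\ y)%SET) + M%:R * Theta.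
  rewrite (@eq_nbr_avg _ _ _ _ (fun z => (f (sleepers eta) + M%:R * Theta)
     + (f (sleepers eta :\ y)%SET - f (sleepers eta)) * v z)); last by move=> z; rewrite /g; ring.
  by rewrite nbr_avgD nbr_avg_cst// nbr_avgZ; ring.
have sleep : settle lambda (dormant A) M (doze eta x) <= f (x |: sleepers eta)%SET + M%:R * Theta.
  rewrite /doze x1 eqxx -sleepers_fall_asleep; apply: hM.
    by have := npart_doze eta x; rewrite /doze x1 eqxx => ->.
  by rewrite sleepers_fall_asleep finset.subUset finset.sub1set xA.
have rho_le : rho * (f (sleepers eta) - f (sleepers eta :\ y)%SET) <=
    nbr_avg v x * (f (sleepers eta) - f (sleepers eta :\ y)%SET).
  by rewrite ler_wpM2r// subr_ge0.
rewrite mulrC ler_pdivrMr//.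
rewrite -(ler_pM2l lambda_gt0) in sleep.
have lT : 0 <= lambda * Theta by rewrite mulr_ge0// ltW.
have : M.+1%:R = M%:R + 1 :> R by rewrite -addn1 natrD.
move=> ->; move: jumps; rewrite gE => jumps.
lra.
Qed.

Let walk_step M : home_bound M.+1 -> walk_bound M -> walk_bound M.+1.
Proof.
move=> hM wM x y v xi z v01 vx vsub xN xA occ.
have fmD y' S : f (S :\ y')%SET <= f S by apply/f_mono/finset.subD1set.
have [->|zx] := eqVneq z x.
  rewrite vx mul0r addr0 subr0 mul1r; apply: hM; first by rewrite npart_add.
  by rewrite sleepers_add (fintype.subset_trans (finset.subD1set _ _)).
have az := active_add xi z.
have ov : (z \notin A) || (2 <= nb_active (add_active xi z) z)%N.
  case: (boolP (z \in A)) => //= zA.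
  by move: (occ z zA zx); rewrite /nb_active add_activeE eqxx; case: (xi z) => [[|k]|].
have MT : M%:R * Theta <= M.+1%:R * Theta.
  by rewrite ler_wpM2r// ler_nat.
apply: le_trans (settle_ignore_sleep _ az ov) _.
set S := sleepers (add_active xi z).
have SA : S \subset A by rewrite /S sleepers_add (fintype.subset_trans (finset.subD1set _ _)).
set g := fun w => (1 - v w) * f S + v w * f (S :\ y)%SET + M%:R * Theta.
have jumps w : settle lambda (dormant A) M (jump (add_active xi z) z w) <= g w.
  have := wM x y v (remove_active (add_active xi z) z) w v01 vx vsub.
  rewrite npart_remove// npart_add sleepers_add sleepers_remove// => /(_ xN SA) h.
  apply: le_trans (h _) _.
    move=> a aA ax; rewrite ffunE; have [eaz|az'] := eqVneq a z.
      move: (occ a aA ax); rewrite eaz /nb_active add_activeE eqxx.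
      by case: (xi z) => [[|k]|].
    by rewrite add_activeE (negPf az') occ.
  have /andP[v0 v1] := v01 w.
  rewrite /g lerD2r lerD//; apply: ler_wpM2l => //; first by rewrite subr_ge0.
  by apply/f_mono/finset.setSD/finset.subD1set.
have gE : nbr_avg g z = f S - nbr_avg v z * (f S - f (S :\ y)%SET) + M%:R * Theta.
  rewrite (@eq_nbr_avg _ _ _ _ (fun w => (f S + M%:R * Theta)
     + (f (S :\ y)%SET - f S) * v w)); last by move=> w; rewrite /g; ring.
  by rewrite nbr_avgD nbr_avg_cst// nbr_avgZ; ring.
apply: le_trans (_ : nbr_avg g z <= _); first exact: nbr_avg_le.
rewrite gE; apply: lerD => //.
have [zy|zy] := eqVneq z y.
  have -> : (S :\ y)%SET = S.
    by apply/setP => a; rewrite !inE add_activeE zy; case: (eqVneq a y).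
  by lra.
have : v z * (f S - f (S :\ y)%SET) <= nbr_avg v z * (f S - f (S :\ y)%SET).
  by rewrite ler_wpM2r ?subr_ge0// vsub.
lra.
Qed.

(** Reaching [asleep A] is a matter of having all the sites of [A] fall asleep
    in turn, where the next site to be toppled, and the sleeping site that its
    particle may wake up, are chosen by [f_step]. The potential [f] decreases on
    average, except for an excess of [Theta] at each toppling. *)
Lemma settle_le_potential M eta : npart eta = #|A| -> sleepers eta \subset A ->
  settle lambda (dormant A) M eta <= f (sleepers eta) + M%:R * Theta.
Proof.
suff : home_bound M /\ walk_bound M by case=> h _; exact: h.
elim: M => [|M [hM wM]]; last first.
  have h := home_step hM wM; split=> //; exact: walk_step.
split=> [{}eta eN eA|x y v xi z v01 _ _ _ _ _].
  rewrite mul0r addr0; have [[x ax]|st] := stable_dec eta; first by rewrite (settle0 _ _ ax).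
  rewrite settle_stable// /dormant; case: eqP => // e.
  suff -> : sleepers eta = A by [].
  by apply/setP => x; rewrite inE e ffunE; case: ifP.
have /andP[v0 v1] := v01 z.
rewrite (settle0 _ _ (active_add _ _)) mul0r addr0 addr_ge0// mulr_ge0//.
by rewrite subr_ge0.
Qed.

End Potential.
End Target.

(** * Potentials on clusters of sites *)

Section Clusters.
Context {R : realType} {d n : nat}.
Variable lambda : R.
Hypothesis lambda_gt0 : 0 < lambda.
Implicit Types (x y : torus d n) (C D S : {set torus d n}) (f g : {set torus d n} -> R).

(** [C] is a cluster in which the sleeping sites are quickly woken up as long as
    some site is active, and [f S] bounds the probability that all of [C] falls
    asleep if [S] is asleep. When all of [C] is active, the particles have
    nothing to wake up in [C] and [f] increases on average, by at most [Q] at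
    each toppling. By [pot_gain], waking up one single site makes [f] decrease
    by [1/2] at least; the margin above [1/2] shrinks at each merger of
    clusters. *)
Record potential C f (Q : R) : Prop := Potential {
  pot_ge0 : forall S, 0 <= f S ;
  pot_le1 : forall S, f S <= 1 ;
  pot_local : forall S S', S :&: C = S' :&: C -> f S = f S' ;
  pot_mono : forall S S', S \subset S' -> f S <= f S' ;
  pot_full : forall S, C \subset S -> f S = 1 ;
  pot_step : forall S, (S :&: C)%SET != finset.set0 -> ~~ (C \subset S) ->
    exists x y rho, [/\ x \in C, x \notin S, y \in C, escape x y rho &
      lambda * (f (x |: S)%SET - f S) <= rho * (f S - f (S :\ y)%SET)] ;
  pot_excess : forall S x, (S :&: C)%SET = finset.set0 -> x \in C ->
    lambda * (f (x |: S)%SET - f S) <= Q ;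
  pot_empty : forall S, (S :&: C)%SET = finset.set0 -> f S <= Q ;
  pot_gain : forall S, ~~ (C \subset S) -> f S <= 1 - (1 + 2^-1 ^+ #|C|) / 2
}.

Lemma potential_ge0 C f Q : potential C f Q -> 0 <= Q.
Proof.
by move=> p; apply: le_trans (pot_ge0 p finset.set0) (pot_empty p _); rewrite finset.set0I.
Qed.

Lemma pot_setU1 C f Q x S : potential C f Q -> x \notin C -> f (x |: S)%SET = f S.
Proof.
move=> p xC; apply: (pot_local p); apply/setP => y; rewrite !inE.
by have [->|//] := eqVneq y x; rewrite (negPf xC) !andbF.
Qed.

Lemma pot_setD1 C f Q x S : potential C f Q -> x \notin C -> f (S :\ x)%SET = f S.
Proof.
move=> p xC; apply: (pot_local p); apply/setP => y; rewrite !inE.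
by have [->|//] := eqVneq y x; rewrite (negPf xC) !andbF.
Qed.

Lemma potential_singleton x : potential [set x]%SET (fun S => (x \in S)%:R) lambda.
Proof.
split.
- by move=> S; exact: ler0n.
- by move=> S; rewrite lern1 leq_b1.
- by move=> S S' /setP/(_ x); rewrite !inE eqxx !andbT => ->.
- move=> S S' /fintype.subsetP SS'; rewrite ler_nat.
  by case: (boolP (x \in S)) => // /SS' ->.
- by move=> S; rewrite finset.sub1set => ->.
- move=> S /finset.set0Pn[y]; rewrite !inE => /andP[yS /eqP yx].
  by rewrite finset.sub1set -yx yS.
- move=> S y Sx; rewrite inE => /eqP->; rewrite !inE eqxx /=.
  rewrite -[leRHS]mulr1; apply: ler_wpM2l; first exact: ltW.
  by rewrite gerBl ler0n.
- move=> S Sx; case: (boolP (x \in S)) => xS; last exact: ltW.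
  have : x \in (S :&: [set x])%SET by rewrite !inE xS eqxx.
  by rewrite Sx inE.
- move=> S; rewrite finset.sub1set => /negPf ->; rewrite cards1 expr1 /=; lra.
Qed.

(** The potential of a union of clusters. The summands [4 * Qc / rho] and
    [4 * Qd / rho] account for the states in which one cluster sleeps while the
    other one is active: the first one is then woken up at a rate of order
    [rho], against a rate [Qc] or [Qd] at which the other one falls asleep. *)
Definition merge_pot f g (Qc Qd rho : R) S : R :=
  (f S + 4 * Qc / rho) * (g S + 4 * Qd / rho) /
  ((1 + 4 * Qc / rho) * (1 + 4 * Qd / rho)).

Lemma merge_potC f g Qc Qd rho S : merge_pot f g Qc Qd rho S = merge_pot g f Qd Qc rho S.
Proof. by rewrite /merge_pot; congr (_ / _); rewrite mulrC. Qed.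

Lemma five_times (u q rho : R) : u <= q / rho -> u + 4 * q / rho <= 5 * (q / rho).
Proof. by rewrite -mulrA; move: (q / rho) => t; lra. Qed.

Lemma merge_gain_arith (u e e' : R) : u <= e / 4 -> e' <= e / 2 -> 0 <= u * (1 - e') ->
  1 - (1 + e) / 2 + u <= (1 - (1 + e') / 2) * (1 + u).
Proof. by move=> ? ? ?; lra. Qed.

(** The properties of [merge_pot f g] which are not symmetric in [C] and [D]. *)
Section Merge.
Variables (C D : {set torus d n}) (f g : {set torus d n} -> R) (Qc Qd rho : R).
Hypothesis CD : [disjoint C & D]%B.
Hypotheses (pC : potential C f Qc) (pD : potential D g Qd).
Hypotheses (rho_gt0 : 0 < rho) (rho_le1 : rho <= 1).
Hypothesis Qc_small : 16 * Qc <= rho * 2^-1 ^+ #|C|.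
Hypothesis D_neq0 : D != finset.set0.

Let h := merge_pot f g Qc Qd rho.
Let a := 4 * Qc / rho.
Let b := 4 * Qd / rho.
Let N := (1 + a) * (1 + b).

Let hE S : h S = (f S + a) * (g S + b) / N.
Proof. by []. Qed.

Let Qc0 : 0 <= Qc := potential_ge0 pC.
Let Qd0 : 0 <= Qd := potential_ge0 pD.
Let a_ge0 : 0 <= a. Proof. by rewrite /a divr_ge0 ?mulr_ge0// ltW. Qed.
Let b_ge0 : 0 <= b. Proof. by rewrite /b divr_ge0 ?mulr_ge0// ltW. Qed.
Let N_ge1 : 1 <= N.
Proof. rewrite /N; have := mulr_ge0 a_ge0 b_ge0; have := a_ge0; have := b_ge0; lra. Qed.
Let N_gt0 : 0 < N. Proof. exact: lt_le_trans N_ge1. Qed.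
Let Ninv : 0 <= N^-1. Proof. by rewrite invr_ge0 ltW. Qed.

Let half_exp k : 0 < (2^-1 : R) ^+ k <= 1.
Proof. by rewrite exprn_gt0 ?invr_gt0// exprn_ile1// ?invr_ge0// invf_le1// ler1n. Qed.

Let a_small : a <= 2^-1 ^+ #|C| / 4.
Proof.
rewrite /a ler_pdivrMr//; move: Qc_small; rewrite [_ / 4 * _]mulrAC.
rewrite [_ * rho]mulrC; set e := rho * _; lra.
Qed.

Let a_le1 : a <= 1.
Proof.
apply: le_trans a_small _; rewrite ler_pdivrMr//.
by have /andP[_ /le_trans->//] := half_exp #|C|; rewrite mul1r ler1n.
Qed.

Let gain_half S : ~~ (C \subset S) -> 2^-1 <= 1 - f S.
Proof.
move=> CS; have := pot_gain pC CS; have /andP[+ _] := half_exp #|C|.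
by move: (_ ^+ _) (f S) => e u; lra.
Qed.

Lemma merge_notr x : x \in C -> x \notin D.
Proof. by move=> xC; rewrite (disjointFr CD xC). Qed.

Lemma merge_notl x : x \in D -> x \notin C.
Proof. by move=> xD; rewrite (disjointFl CD xD). Qed.

Lemma merge_pot_step S : (S :&: C)%SET != finset.set0 -> ~~ (C \subset S) ->
  exists x y r, [/\ x \in C, x \notin S, y \in C, escape x y r &
    lambda * (h (x |: S)%SET - h S) <= r * (h S - h (S :\ y)%SET)].
Proof.
move=> S0 S1; have [x [y [r [xC xS yC e st]]]] := pot_step pC S0 S1.
exists x, y, r; split=> //; rewrite !hE.
rewrite (pot_setU1 _ pD (merge_notr xC)) (pot_setD1 _ pD (merge_notr yC)).
have gb : 0 <= (g S + b) / N by rewrite mulr_ge0 ?addr_ge0 ?(pot_ge0 pD).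
by move: (ler_wpM2r gb st); lra.
Qed.

(** Here [C] sleeps and [D] is active: the toppled particle may fall asleep
    in [D], or wake up [C]. *)
Lemma merge_pot_cross x y S : x \in C -> y \in D -> C \subset S ->
  (S :&: D)%SET = finset.set0 ->
  lambda * (h (y |: S)%SET - h S) <= rho * (h S - h (S :\ x)%SET).
Proof.
move=> xC yD CS SD; rewrite !hE.
rewrite (pot_setU1 _ pC (merge_notl yD)) (pot_setD1 _ pD (merge_notr xC)).
have f1 := pot_full pC CS; rewrite f1.
have xS : ~~ (C \subset S :\ x)%SET.
  by apply/negP => /fintype.subsetP/(_ x xC); rewrite !inE eqxx.
have ex := pot_excess pD SD yD.
rewrite -!mulrBl !mulrA ler_wpM2r//.
have -> : lambda * ((1 + a) * (g (y |: S)%SET + b) - (1 + a) * (g S + b)) =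
  (1 + a) * (lambda * (g (y |: S)%SET - g S)) by ring.
apply: le_trans (_ : 2 * Qd <= _).
  apply: ler_pM => //.
  - by rewrite addr_ge0.
  - by rewrite mulr_ge0 ?(ltW lambda_gt0)// subr_ge0 (pot_mono pD)// finset.subsetUr.
  - by rewrite -[2]/(1 + 1) lerD2l.
apply: le_trans (_ : rho * (2^-1 * b) <= _).
  rewrite le_eqVlt; apply/orP; left; apply/eqP; rewrite /b; field; exact: lt0r_neq0.
rewrite -mulrA ler_wpM2l ?(ltW rho_gt0)//; apply: ler_pM => //.
- by rewrite opprD addrACA subrr addr0; exact: gain_half.
- by rewrite lerDr (pot_ge0 pD).
Qed.

Lemma merge_pot_excess S x : (S :&: C)%SET = finset.set0 -> (S :&: D)%SET = finset.set0 ->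
  x \in C -> lambda * (h (x |: S)%SET - h S) <= 25 * Qc * Qd / rho ^+ 2.
Proof.
move=> SC SD xC; rewrite !hE (pot_setU1 _ pD (merge_notr xC)).
have ex := pot_excess pC SC xC; have em := pot_empty pD SD.
have -> : lambda * ((f (x |: S)%SET + a) * (g S + b) / N - (f S + a) * (g S + b) / N) =
  lambda * (f (x |: S)%SET - f S) * (g S + b) / N by ring.
have r1 : 1 <= rho^-1 by rewrite invf_ge1.
have Qdr : Qd <= Qd / rho by rewrite ler_peMr.
have Qcr : Qc <= Qc / rho by rewrite ler_peMr.
have gb : 0 <= g S + b by rewrite addr_ge0// (pot_ge0 pD).
have ex0 : 0 <= lambda * (f (x |: S)%SET - f S).
  by rewrite mulr_ge0 ?(ltW lambda_gt0)// subr_ge0 (pot_mono pC)// finset.subsetUr.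
rewrite ler_pdivrMr//; apply: le_trans (_ : 25 * Qc * Qd / rho ^+ 2 * 1 <= _); last first.
  by rewrite ler_wpM2l// !mulr_ge0// invr_ge0 exprn_ge0// ltW.
rewrite mulr1 (_ : _ / rho ^+ 2 = (5 * (Qc / rho)) * (5 * (Qd / rho))); last first.
  by field; exact: lt0r_neq0.
apply: ler_pM => //.
  apply: le_trans ex _; apply: le_trans Qcr _; rewrite ler_peMl ?ler1n//.
  by rewrite divr_ge0// ltW.
by apply: five_times; exact: le_trans Qdr.
Qed.

Lemma merge_pot_gain S : ~~ (C \subset S) -> h S <= 1 - (1 + 2^-1 ^+ #|C :|: D|%SET) / 2.
Proof.
move=> CS; rewrite hE ler_pdivrMr//.
have gain := pot_gain pC CS; have /andP[e0 e1] := half_exp #|C|.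
have card : 2^-1 ^+ #|C :|: D|%SET <= 2^-1 ^+ #|C| / 2 :> R.
  rewrite -exprSr; apply: ler_wiXn2l; rewrite ?invr_ge0// ?invf_le1 ?ler1n//.
  rewrite cardsU (_ : (C :&: D)%SET = finset.set0) ?cards0 ?subn0.
    by rewrite -addn1 leq_add2l card_gt0.
  by apply/eqP; rewrite finset.setI_eq0.
apply: le_trans (_ : (1 - (1 + 2^-1 ^+ #|C|) / 2 + a) * (1 + b) <= _).
  apply: ler_pM; rewrite ?addr_ge0 ?(pot_ge0 pC) ?(pot_ge0 pD)//.
    by rewrite lerD2r.
  by rewrite lerD2r (pot_le1 pD).
rewrite /N mulrA; apply: ler_wpM2r; first by rewrite addr_ge0.
have : 0 <= a * (1 - 2^-1 ^+ #|C :|: D|%SET).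
  by rewrite mulr_ge0// subr_ge0; have /andP[] := half_exp #|C :|: D|%SET.
exact: merge_gain_arith.
Qed.

End Merge.

(** If [C] sleeps and [D] is active, a toppled particle of [D] increases the
    potential by a multiple of [Qd] when it falls asleep, but it reaches [C] with
    probability [rho], and then decreases [f] by [1/2] thanks to [pot_gain]. The
    powers of [1/2] in the hypotheses keep the margin of [pot_gain] after the
    division by the value of the sum at the sleeping configuration. *)
Lemma potential_merge C D f g Qc Qd rho x y :
  [disjoint C & D]%B -> potential C f Qc -> potential D g Qd ->
  x \in C -> y \in D -> escape x y rho -> escape y x rho ->
  0 < rho <= 1 -> 16 * Qc <= rho * 2^-1 ^+ #|C| -> 16 * Qd <= rho * 2^-1 ^+ #|D| ->
  potential (C :|: D) (merge_pot f g Qc Qd rho) (25 * Qc * Qd / rho ^+ 2).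
Proof.
move=> CD pC pD xC yD exy eyx /andP[r0 r1] Cs Ds.
have DC : [disjoint D & C]%B by rewrite disjoint_sym.
have C0 : C != finset.set0 by apply/finset.set0Pn; exists x.
have D0 : D != finset.set0 by apply/finset.set0Pn; exists y.
have Qc0 := potential_ge0 pC; have Qd0 := potential_ge0 pD.
have a0 : 0 <= 4 * Qc / rho by rewrite divr_ge0 ?mulr_ge0// ltW.
have b0 : 0 <= 4 * Qd / rho by rewrite divr_ge0 ?mulr_ge0// ltW.
have N1 : 1 <= (1 + 4 * Qc / rho) * (1 + 4 * Qd / rho) by rewrite mulr_ege1// lerDl.
have N0 := lt_le_trans ltr01 N1.
have swap : merge_pot g f Qd Qc rho = merge_pot f g Qc Qd rho.
  by apply/funext => S; rewrite merge_potC.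
have Qswap : 25 * Qd * Qc / rho ^+ 2 = 25 * Qc * Qd / rho ^+ 2 by rewrite -(mulrA 25) (mulrC Qd) mulrA.
have fa S : 0 <= f S + 4 * Qc / rho by rewrite addr_ge0// (pot_ge0 pC).
have gb S : 0 <= g S + 4 * Qd / rho by rewrite addr_ge0// (pot_ge0 pD).
split.
- by move=> S; apply: divr_ge0; [exact: mulr_ge0|exact: ltW].
- move=> S; rewrite /merge_pot ler_pdivrMr// mul1r; apply: ler_pM => //; rewrite lerD2r.
    exact: (pot_le1 pC).
  exact: (pot_le1 pD).
- move=> S S' SS'; have loc (E : {set torus d n}) : E \subset (C :|: D)%SET -> (S :&: E)%SET = (S' :&: E)%SET.
    by move=> /finset.setIidPr <-; rewrite !finset.setIA SS'.
  rewrite /merge_pot (pot_local pC (S' := S')) ?(pot_local pD (S' := S'))// loc//.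
    exact: finset.subsetUr.
  exact: finset.subsetUl.
- move=> S S' SS'; rewrite /merge_pot ler_pM2r ?invr_gt0//.
  by apply: ler_pM => //; rewrite lerD2r ?(pot_mono pC) ?(pot_mono pD).
- move=> S; rewrite finset.subUset => /andP[CS DS].
  by rewrite /merge_pot (pot_full pC CS) (pot_full pD DS) divff// gt_eqF.
- move=> S; rewrite finset.setIUr finset.setU_eq0 negb_and finset.subUset negb_and => S0 S1.
  have [/andP[SC0 CS]|mixC] := boolP ((S :&: C != finset.set0) && ~~ (C \subset S))%SET.
    have [u [v [r [uC uS vC e st]]]] :=
      merge_pot_step CD pC pD r0 SC0 CS.
    by exists u, v, r; rewrite !inE uC vC.
  have [/andP[SD0 DS]|mixD] := boolP ((S :&: D != finset.set0) && ~~ (D \subset S))%SET.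
    have [u [v [r [uD uS vD e st]]]] :=
      merge_pot_step DC pD pC r0 SD0 DS.
    by exists u, v, r; rewrite !inE uD vD !orbT; rewrite swap in st.
  have notin E z : (S :&: E)%SET = finset.set0 -> z \in E -> z \notin S.
    move=> SE zE; apply: contraT; rewrite negbK => zS.
    by have : z \in (S :&: E)%SET; [rewrite inE zS|rewrite SE inE].
  move: mixC mixD; rewrite !negb_and !negbK.
  case/orP => [/eqP SC0|CS] /orP[/eqP SD0|DS].
  + by rewrite SC0 SD0 eqxx in S0.
  + exists x, y, rho; rewrite !inE xC yD orbT; split=> //; first exact: notin SC0 xC.
    have := merge_pot_cross DC pD pC r0 Ds yD xC DS SC0.
    by rewrite swap.
  + exists y, x, rho; rewrite !inE xC yD orbT; split=> //; first exact: notin SD0 yD.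
    exact: (merge_pot_cross CD pC pD r0 Cs xC yD CS SD0).
  + by rewrite CS DS in S1.
- move=> S z; rewrite finset.setIUr => /eqP; rewrite finset.setU_eq0.
  move=> /andP[/eqP SC /eqP SD]; rewrite inE => /orP[zC|zD].
    exact: (merge_pot_excess CD pC pD r0 r1 SC SD zC).
  by rewrite -swap -Qswap; exact: (merge_pot_excess DC pD pC r0 r1 SD SC zD).
- move=> S; rewrite finset.setIUr => /eqP; rewrite finset.setU_eq0.
  move=> /andP[/eqP SC /eqP SD].
  have em := pot_empty pC SC; have em' := pot_empty pD SD.
  have ri : 1 <= rho^-1 by rewrite invf_ge1.
  have Qdr : Qd <= Qd / rho by rewrite ler_peMr.
  have Qcr : Qc <= Qc / rho by rewrite ler_peMr.
  rewrite /merge_pot ler_pdivrMr//; apply: le_trans (_ : 25 * Qc * Qd / rho ^+ 2 * 1 <= _); last first.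
    by rewrite ler_wpM2l// !mulr_ge0// invr_ge0 exprn_ge0// ltW.
  rewrite mulr1 (_ : _ / rho ^+ 2 = (5 * (Qc / rho)) * (5 * (Qd / rho))); last first.
    by field; exact: lt0r_neq0.
  by apply: ler_pM => //; apply: five_times; exact: le_trans Qcr || exact: le_trans Qdr.
- move=> S; rewrite finset.subUset negb_and => /orP[CS|DS].
    exact: (merge_pot_gain CD pC pD).
  by rewrite -swap finset.setUC; exact: (merge_pot_gain DC pD pC).
Qed.

End Clusters.

(** * Hitting probabilities on the torus *)

Section Geometry.
Context {d n : nat}.
Implicit Types (a b : 'I_n) (x y z : torus d n).

Definition cyc_dist a b : nat := minn ((a - b) + (b - a)) (n - ((a - b) + (b - a))).

Definition torus_dist x y : nat := \sum_i cyc_dist (x i) (y i).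

Lemma ordS_val a : ordS a = (if a.+1 == n then 0 else a.+1) :> nat.
Proof.
rewrite /=; case: eqVneq => [->|an]; first by rewrite modnn.
by rewrite modn_small// ltn_neqAle an ltn_ord.
Qed.

Lemma ord_pred_val a : ord_pred a = (if a == 0 :> nat then n.-1 else a.-1) :> nat.
Proof.
have := ltn_ord a; rewrite /=; case: eqVneq => [->|a0 an].
  by move=> n0; rewrite add0n modn_small// prednK.
have -> : ((a + n).-1 = a.-1 + n)%N by lia.
by rewrite modnDr modn_small//; lia.
Qed.

Lemma cyc_distC a b : cyc_dist a b = cyc_dist b a.
Proof. by rewrite /cyc_dist addnC. Qed.

Lemma cyc_dist_eq0 a b : (cyc_dist a b == 0%N) = (a == b).
Proof.
have := ltn_ord a; have := ltn_ord b; rewrite /cyc_dist -(inj_eq val_inj) /=.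
by move=> ? ?; apply/idP/idP; lia.
Qed.

Lemma cyc_dist_ordS a b : (cyc_dist (ordS a) b <= (cyc_dist a b).+1)%N.
Proof.
have := ltn_ord a; have := ltn_ord b; rewrite /cyc_dist ordS_val.
by case: eqP; lia.
Qed.

Lemma cyc_dist_ord_pred a b : (cyc_dist (ord_pred a) b <= (cyc_dist a b).+1)%N.
Proof.
have := ltn_ord a; have := ltn_ord b; rewrite /cyc_dist ord_pred_val.
by case: eqP; lia.
Qed.

Lemma cyc_dist_closer a b : a != b ->
  (cyc_dist (ordS a) b < cyc_dist a b)%N || (cyc_dist (ord_pred a) b < cyc_dist a b)%N.
Proof.
have := ltn_ord a; have := ltn_ord b; rewrite -(inj_eq val_inj) /cyc_dist ordS_val ord_pred_val /=.
by do 3 case: eqP => ?; lia.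
Qed.

Lemma torus_distC x y : torus_dist x y = torus_dist y x.
Proof. by apply: eq_bigr => i _; rewrite cyc_distC. Qed.

Lemma torus_dist_gt0 x y : x != y -> (0 < torus_dist x y)%N.
Proof.
move=> xy; rewrite lt0n sum_nat_eq0; apply: contra xy => /forallP h.
by apply/eqP/ffunP => i; apply/eqP; rewrite -cyc_dist_eq0; exact: h i.
Qed.

Lemma torus_dist_next x y i : (torus_dist (torus_next x i) y <= (torus_dist x y).+1)%N.
Proof.
rewrite /torus_dist (bigD1 i)//= [X in (_ <= X.+1)%N](bigD1 i)//= -addSn ffunE eqxx.
by rewrite leq_add ?cyc_dist_ordS// leq_sum// => j /negPf ji; rewrite ffunE ji.
Qed.

Lemma torus_dist_prev x y i : (torus_dist (torus_prev x i) y <= (torus_dist x y).+1)%N.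
Proof.
rewrite /torus_dist (bigD1 i)//= [X in (_ <= X.+1)%N](bigD1 i)//= -addSn ffunE eqxx.
by rewrite leq_add ?cyc_dist_ord_pred// leq_sum// => j /negPf ji; rewrite ffunE ji.
Qed.

Lemma torus_dist_closer x y : x != y -> exists (i : 'I_d) (b : bool),
  (torus_dist (if b then torus_next x i else torus_prev x i) y < torus_dist x y)%N.
Proof.
move=> xy; have [i xyi] : exists i, x i != y i.
  by apply/existsP; apply: contraR xy; rewrite negb_exists => /forallP h;
     apply/eqP/ffunP => i; apply/eqP; move: (h i); rewrite negbK.
case/orP: (cyc_dist_closer xyi) => lt; exists i.
  exists true; rewrite /torus_dist (bigD1 i)//= [X in (_ < X)%N](bigD1 i)//= -addSn ffunE eqxx.
  by rewrite leq_add// leq_sum// => j /negPf ji; rewrite ffunE ji.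
exists false; rewrite /torus_dist (bigD1 i)//= [X in (_ < X)%N](bigD1 i)//= -addSn ffunE eqxx.
by rewrite leq_add// leq_sum// => j /negPf ji; rewrite ffunE ji.
Qed.

(** Pigeonhole principle: the torus is cut into at most [q ^ d < k] cells of
    side [n / q]. *)
Lemma close_sites (k : nat) (x : 'I_k -> torus d n) : (0 < d)%N -> (1 < k)%N ->
  exists i j, i != j /\ ((torus_dist (x i) (x j)) ^ d * k <= (2 * d) ^ d * n ^ d)%N.
Proof.
move=> d0 k1; have exq : exists q, (k <= q.+1 ^ d)%N.
  exists k; apply: leq_trans (leqnSn k) _; rewrite -[leqLHS]expn1.
  exact: leq_pexp2l.
case: (ex_minnP exq) => q kq qmin.
have q0 : (0 < q)%N by rewrite lt0n; apply: contraTneq kq => ->; rewrite exp1n -ltnNge.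
have qk : (q ^ d < k)%N.
  by rewrite ltnNge; apply/negP; move: (qmin q.-1); rewrite prednK// => h /h; lia.
have n0 (i : 'I_k) : (0 < n)%N.
  exact: leq_ltn_trans (ltn_ord (x i (Ordinal d0))).
have cellP i (j : 'I_d) : (x i j * q %/ n < q)%N.
  by rewrite ltn_divLR ?(n0 i)// mulnC ltn_pmul2l.
pose cell i : {ffun 'I_d -> 'I_q} := [ffun j => Ordinal (cellP i j)].
have /injectivePn[i [j ij eij]] : ~~ injectiveb cell.
  apply/injectiveP => /leq_card; rewrite card_ffun !card_ord.
  by rewrite leqNgt qk.
exists i, j; split=> //.
have cyc l : (cyc_dist (x i l) (x j l) * q <= n)%N.
  have /(congr1 (fun c : {ffun 'I_d -> 'I_q} => val (c l))) := eij.
  rewrite !ffunE /= => e.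
  have := divn_eq (x i l * q) n; have := divn_eq (x j l * q) n; rewrite e.
  have := ltn_pmod (x i l * q) (n0 i); have := ltn_pmod (x j l * q) (n0 i).
  move: (_ %/ _)%N (_ %% _)%N (_ %% _)%N => c u v vn un ev eu.
  apply: leq_trans (_ : ((x i l - x j l) + (x j l - x i l)) * q <= _)%N.
    by rewrite leq_mul2r geq_minl orbT.
  rewrite mulnDl !mulnBl; lia.
have dq : (torus_dist (x i) (x j) * q <= d * n)%N.
  rewrite /torus_dist big_distrl/= -[d in (_ <= d * _)%N]card_ord -sum_nat_const.
  exact: leq_sum.
have dq1 : (torus_dist (x i) (x j) * q.+1 <= 2 * d * n)%N.
  by apply: leq_trans (_ : torus_dist (x i) (x j) * (2 * q) <= _)%N; [rewrite leq_mul2l; lia|lia].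
rewrite -expnMn; apply: leq_trans (_ : (torus_dist (x i) (x j) * q.+1) ^ d <= _)%N.
  by rewrite expnMn leq_mul2l kq orbT.
by rewrite leq_exp2r.
Qed.

End Geometry.

Section Escape.
Context {R : realType} {d n : nat}.
Hypothesis d_gt0 : (0 < d)%N.
Implicit Types x y z : torus d n.

Let gam : R := (2 * d%:R - 1)^-1.

Let d1 : 1 <= d%:R :> R. Proof. by rewrite ler1n. Qed.
Let g0 : 0 < gam. Proof. by rewrite invr_gt0; move: d1; lra. Qed.
Let g1 : gam <= 1. Proof. by rewrite invf_le1; move: d1; lra. Qed.

(** The distance to [y] decreases with probability at least [1/2d] and increases
    by at most one. Hence a walk at distance [r] from [y] comes closer with at
    least the ruin probability of the gambler who wins with probability
    [1/2d]. *)
Lemma escape_dist x y : x != y ->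
  escape x y (gam ^+ (torus_dist x y).-1 / (2 * d%:R * (torus_dist x y)%:R)).
Proof.
move=> xy; set r := torus_dist x y; have r0 : (0 < r)%N by exact: torus_dist_gt0.
pose S D : R := \sum_(D <= i < r) gam ^+ i.
have S_ge0 D : 0 <= S D by apply: sumr_ge0 => i _; rewrite exprn_ge0// ltW.
have S_rec D : (D < r)%N -> S D = gam ^+ D + S D.+1 by move=> Dr; rewrite /S big_ltn.
have S_out D : (r <= D)%N -> S D = 0 by move=> rD; rewrite /S big_geq.
have S_anti D E : (D <= E)%N -> S E <= S D.
  move=> DE; have [Er|rE] := leqP E r; last by rewrite (S_out E) 1?ltnW.
  rewrite /S (big_cat_nat DE Er)/= lerDr sumr_ge0// => i _.
  by rewrite exprn_ge0// ltW.
have S0 : 0 < S 0%N by rewrite S_rec// expr0 ltr_pwDl.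
have p0 : 0 < (2 * d%:R : R)^-1 by rewrite invr_gt0; move: d1; lra.
have p1 : (2 * d%:R : R)^-1 <= 1 by rewrite invf_le1; move: d1; lra.
pose v z := S (torus_dist z y) / S 0%N.
have v_ge0 z : 0 <= v z by rewrite divr_ge0// ltW.
have nbrs z : z != y ->
    (2 * d%:R)^-1 * (S (torus_dist z y).-1 / S 0%N) +
    (1 - (2 * d%:R)^-1) * (S (torus_dist z y).+1 / S 0%N) <= nbr_avg v z.
  move=> zy; have [i [b lt]] := torus_dist_closer zy.
  have D0 := torus_dist_gt0 zy.
  (* [nbr_avg_ge_nbr] wants a lower bound at all sites, not only at the
     neighbours of [z]. *)
  pose w z' := Num.max (v z') (S (torus_dist z y).+1 / S 0%N).
  have step j (b' : bool) : S (torus_dist z y).+1 / S 0%N <=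
      v (if b' then torus_next z j else torus_prev z j).
    by rewrite ler_pM2r ?invr_gt0//; apply: S_anti; case: b'; rewrite ?torus_dist_next ?torus_dist_prev.
  have -> : nbr_avg v z = nbr_avg w z.
    apply: eq_bigr => j _; rewrite /w !max_l//.
      exact: (step j false).
    exact: (step j true).
  apply: (nbr_avg_ge_nbr d_gt0 (i := i) (b := b)); last first.
    by move=> z'; rewrite /w le_max lexx orbT.
  rewrite /w le_max; apply/orP; left.
  by rewrite ler_pM2r ?invr_gt0//; apply: S_anti; move: lt D0; case: b; lia.
exists v.
  split.
  - move=> z; rewrite v_ge0 /v ler_pdivrMr// mul1r; exact: S_anti.
  - by rewrite /v S_out ?mul0r.
  - move=> z zx zy; apply: le_trans (nbrs z zy).
    have D0 := torus_dist_gt0 zy.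
    have [rD|Dr] := leqP r (torus_dist z y).
      rewrite /v S_out// mul0r addr_ge0// mulr_ge0 ?subr_ge0 ?divr_ge0//; exact: ltW.
    rewrite /v !mulrA -mulrDl ler_pM2r ?invr_gt0//.
    move: D0 Dr; case: (torus_dist z y) => [//|D] _ Dr /=.
    have := S_rec _ Dr; have := S_rec _ (ltnW Dr); rewrite exprS.
    set u := gam ^+ D; have gu : u = gam * u * (2 * d%:R - 1).
      by rewrite /gam; field; move: d1; lra.
    move=> -> e.
    have -> : (2 * d%:R)^-1 * (u + S D.+1) + (1 - (2 * d%:R)^-1) * S D.+2 =
      S D.+2 + (2 * d%:R)^-1 * (u + (S D.+1 - S D.+2)) by ring.
    rewrite {1}e addrC lerD2l e addrK.
    have -> : u + gam * u = 2 * d%:R * (gam * u) by rewrite {1}gu; ring.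
    by rewrite mulKf// -invr_eq0 gt_eqF.
apply: le_trans (nbrs x xy); rewrite -/r (S_out r.+1)// mul0r mulr0 addr0.
rewrite S_rec ?prednK// S_out ?prednK// addr0 mulrC invfM -mulrA ler_pM2l//.
rewrite mulrC ler_pM2l ?exprn_gt0// lef_pV2 ?posrE ?ltr0n//.
rewrite /S big_mkord -[leRHS]mulr1 mulr_natl -[r in _ *+ r]card_ord -sumr_const.
by apply: ler_sum => i _; rewrite exprn_ile1// ltW.
Qed.

End Escape.

(** * Merging clusters *)

Section Merging.
Context {R : realType} {d n : nat}.
Hypothesis d_gt0 : (0 < d)%N.
Variable lambda : R.
Hypothesis lambda_gt0 : 0 < lambda.
Implicit Types (x y : torus d n) (A C D E : {set torus d n}).

Definition merge_cost : R := 8 * d%:R ^+ 2 + 8 * d%:R + 8.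

Let d1 : 1 <= d%:R :> R. Proof. by rewrite ler1n. Qed.

Lemma expR_ge_id (t : R) : t <= expR t.
Proof. by apply: le_trans (expR_ge1Dx t); rewrite lerDr. Qed.

(** With [k] clusters left, two of them are at distance [O((V/k)^(1/d))] for the
    volume [V = n^d]. In dimension one [1/rho] is of the order of this
    distance, and in higher dimensions it is at most exponential in it, so that
    [exp (O (sqrt (V/k)))] is a bound in all dimensions. *)
Lemma inv_escape_le (r k : nat) : (0 < r)%N -> (0 < k)%N -> (k <= n ^ d)%N ->
  (r ^ d * k <= (2 * d) ^ d * n ^ d)%N ->
  2 * d%:R * r%:R * (2 * d%:R - 1) ^+ r.-1 <=
  expR ((4 * d%:R ^+ 2 + 4 * d%:R) * Num.sqrt ((n ^ d)%:R / k%:R)) :> R.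
Proof.
move=> r0 k0 kV rk; set t := Num.sqrt _.
have kR : 0 < k%:R :> R by rewrite ltr0n.
have t2 : t ^+ 2 = (n ^ d)%:R / k%:R by rewrite sqr_sqrtr// divr_ge0.
have t1 : 1 <= t.
  by rewrite -[leLHS]sqrtr1 ler_sqrt ?divr_ge0// ler_pdivlMr// mul1r ler_nat.
have rt : (r%:R / (2 * d%:R)) ^+ d <= t ^+ 2.
  rewrite t2 expr_div_n ler_pdivrMr; last by rewrite exprn_gt0//; move: d1; lra.
  rewrite mulrAC ler_pdivlMr// mulrC -!natrX -!natrM.
  by move: rk; rewrite -(ler_nat R) !natrM !natrX natrM mulrC [leRHS]mulrC.
have [d2|] := leqP 2 d; last first.
  move=> d2; have dE : d = 1%N by lia.
  move: rt; rewrite dE !expr1 !mulr1 => rt.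
  have -> : 2 - 1 = 1 :> R by lra.
  rewrite expr1n mulr1; apply: le_trans (_ : expR 1 ^+ 2 * (expR t) ^+ 2 <= _).
    apply: le_trans (_ : 2 ^+ 2 * t ^+ 2 <= _); first by move: rt; lra.
    have e1 : 2 <= expR 1 :> R by exact: expR_ge1Dx.
    apply: ler_pM; rewrite ?exprn_ge0//; last 2 first.
    - by rewrite ler_pXn2r ?nnegrE ?expR_ge0.
    - by rewrite ler_pXn2r ?nnegrE ?expR_ge0 ?expR_ge_id//; move: t1; lra.
    by move: t1; lra.
  by rewrite -!expRM_natl -expRD ler_expR; move: t1; lra.
have rt' : r%:R <= 2 * d%:R * t.
  rewrite mulrC -ler_pdivrMr; last by move: d1; lra.
  move: rt; apply: contraTT; rewrite -!ltNge => lt.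
  apply: le_lt_trans (ler_weXn2l t1 d2) _.
  by rewrite ltr_pXn2r ?nnegrE ?divr_ge0//; move: t1 d1; lra.
apply: le_trans (_ : expR (2 * d%:R) * expR r%:R * expR (2 * d%:R) ^+ r <= _).
  have e0 (u : R) : 0 <= u -> 0 <= expR u by move=> _; exact: expR_ge0.
  have dd : 0 <= 2 * d%:R :> R by move: d1; lra.
  have dd' : 0 <= 2 * d%:R - 1 :> R by move: d1; lra.
  apply: ler_pM; rewrite ?mulr_ge0 ?exprn_ge0 ?ler0n//.
    by apply: ler_pM; rewrite ?ler0n ?expR_ge_id.
  apply: le_trans (_ : expR (2 * d%:R) ^+ r.-1 <= _).
    rewrite lerXn2r ?nnegrE ?expR_ge0//.
    by apply: le_trans (expR_ge_id _); lra.
  by rewrite ler_weXn2l ?leq_pred// -expR0 ler_expR.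
rewrite -expRM_natl -!expRD ler_expR.
have : 2 * d%:R <= 2 * d%:R * t by rewrite ler_peMr//; move: d1; lra.
have : r%:R * (2 * d%:R) <= 2 * d%:R * t * (2 * d%:R).
  by rewrite ler_wpM2r//; move: d1; lra.
by move: rt'; rewrite expr2; clear; move: t (r%:R : R) (d%:R : R) => t u D; lra.
Qed.

Lemma close_escape x y (k : nat) : x != y -> (0 < k)%N -> (k <= n ^ d)%N ->
  (torus_dist x y ^ d * k <= (2 * d) ^ d * n ^ d)%N ->
  exists rho, [/\ 0 < rho <= 1, escape x y rho, escape y x rho &
    25 / rho ^+ 2 <= expR (merge_cost * Num.sqrt ((n ^ d)%:R / k%:R))].
Proof.
move=> xy k0 kV rk; have r0 := torus_dist_gt0 xy.
have := inv_escape_le r0 k0 kV rk.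
have := escape_dist (R := R) d_gt0 xy.
have yx : y != x by rewrite eq_sym.
have := escape_dist (R := R) d_gt0 yx; rewrite (torus_distC y x).
move: (torus_dist x y) r0 rk => r r0 rk eyx exy cost.
set t := Num.sqrt _ in cost *.
have t1 : 1 <= t.
  by rewrite -[leLHS]sqrtr1 ler_sqrt ?divr_ge0// ler_pdivlMr ?ltr0n// mul1r ler_nat.
set rho := _ / _ in exy eyx.
have D1 : 0 < 2 * d%:R - 1 :> R by move: d1; lra.
have rhoV : rho^-1 = 2 * d%:R * r%:R * (2 * d%:R - 1) ^+ r.-1.
  by rewrite /rho invf_div exprVn invrK.
have rho1 : 1 <= rho^-1.
  rewrite rhoV !mulr_ege1 ?exprn_ege1 ?ler1n//; move: d1; lra.
have rho0 : 0 < rho by rewrite -invr_gt0; exact: lt_le_trans rho1.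
exists rho; split=> //.
  by rewrite rho0/= -invf_ge1.
rewrite -exprVn; apply: le_trans (_ : expR (8 * t) *
    (expR ((4 * d%:R ^+ 2 + 4 * d%:R) * t)) ^+ 2 <= _); last first.
  rewrite -expRM_natl -expRD ler_expR /merge_cost.
  by clear; move: t (d%:R ^+ 2 : R) (d%:R : R) => t u D; lra.
apply: ler_pM => //.
- by rewrite exprn_ge0// invr_ge0 ltW.
- apply: le_trans (_ : (2 : R) ^+ 8 <= _); first by rewrite -natrX ler_nat.
  rewrite expRM_natl; apply: le_trans (_ : expR 1 ^+ 8 <= _).
    by rewrite lerXn2r ?nnegrE ?expR_ge0//; exact: expR_ge1Dx.
  by rewrite lerXn2r ?nnegrE ?expR_ge0// ler_expR.
- by rewrite lerXn2r ?nnegrE ?expR_ge0 ?invr_ge0 ?(ltW rho0)// rhoV.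
Qed.

(** The bound [Q] on the excess is written as [W * 2^-#|C|]. The weight [W] is
    what can be kept track of when a cluster is given up: its excess is then
    too large for a merger, hence [W >= rho / 16]. *)
Definition weighted C (W : R) : Prop := exists f, potential lambda C f (W * 2^-1 ^+ #|C|).

Let half_gt0 k : 0 < (2^-1 : R) ^+ k.
Proof. by rewrite exprn_gt0// invr_gt0. Qed.

Lemma weighted_ge0 C W : weighted C W -> 0 <= W.
Proof. by case=> f /(potential_ge0); rewrite pmulr_lge0. Qed.

Lemma weighted_merge_or_drop C D Wc Wd x y rho : [disjoint C & D]%B ->
  weighted C Wc -> weighted D Wd -> x \in C -> y \in D ->
  escape x y rho -> escape y x rho -> 0 < rho <= 1 ->
  exists E W, [/\ E \subset (C :|: D)%SET, E != finset.set0, weighted E W &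
    W <= Wc * Wd * (25 / rho ^+ 2)].
Proof.
move=> CD wC wD xC yD exy eyx /andP[r0 r1].
have Wc0 := weighted_ge0 wC; have Wd0 := weighted_ge0 wD.
have drop W : 0 <= W -> rho < 16 * W -> 1 <= W * (25 / rho ^+ 2).
  move=> W0 rW; rewrite mulrA ler_pdivlMr ?exprn_gt0// mul1r.
  apply: le_trans (_ : rho * 1 <= _); first by rewrite expr2 ler_pM2l.
  by move: rW W0; lra.
have [Wc_small|Wc_big] := leP (16 * Wc) rho; last first.
  exists D, Wd; split=> //; first exact: finset.subsetUr.
    by apply/finset.set0Pn; exists y.
  by rewrite (mulrC Wc) -mulrA ler_peMr// drop.
have [Wd_small|Wd_big] := leP (16 * Wd) rho; last first.
  exists C, Wc; split=> //; first exact: finset.subsetUl.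
    by apply/finset.set0Pn; exists x.
  by rewrite -mulrA ler_peMr// drop.
exists (C :|: D)%SET, (Wc * Wd * (25 / rho ^+ 2)); split=> //.
  by apply/finset.set0Pn; exists x; rewrite inE xC.
case: wC wD => f pC [g pD]; exists (merge_pot f g (Wc * 2^-1 ^+ #|C|) (Wd * 2^-1 ^+ #|D|) rho).
rewrite (_ : Wc * Wd * (25 / rho ^+ 2) * _ =
  25 * (Wc * 2^-1 ^+ #|C|) * (Wd * 2^-1 ^+ #|D|) / rho ^+ 2).
  apply: (potential_merge lambda_gt0 CD pC pD xC yD exy eyx); rewrite ?r0//.
    by rewrite mulrA ler_pM2r.
  by rewrite mulrA ler_pM2r.
have -> : #|C :|: D|%SET = (#|C| + #|D|)%N.
  rewrite cardsU (_ : (C :&: D)%SET = finset.set0) ?cards0 ?subn0//.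
  by apply/eqP; rewrite finset.setI_eq0.
by rewrite exprD; move: (_ ^+ #|C|) (_ ^+ #|D|) => u v; ring.
Qed.

Lemma weighted_family (k : nat) (s : seq ({set torus d n} * R)) A :
  size s = k.+1 -> (size s <= n ^ d)%N -> uniq s ->
  (forall c, c \in s -> [/\ c.1 \subset A, c.1 != finset.set0 & weighted c.1 c.2]) ->
  {in s &, forall c c' : {set torus d n} * R, c != c' -> [disjoint c.1 & c'.1]%B} ->
  exists C W, [/\ C \subset A, C != finset.set0, weighted C W &
    W <= \prod_(c <- s) c.2 *
         \prod_(2 <= j < k.+2) expR (merge_cost * Num.sqrt ((n ^ d)%:R / j%:R))].
Proof.
elim: k s => [|k IH] s sk sV us ws ds.
  case: s sk sV us ws ds => [//|c [|//]] _ _ _ ws _.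
  have [cA c0 wc] := ws c (mem_head _ _); exists c.1, c.2; split=> //.
  by rewrite big_seq1 big_geq// mulr1.
pose c0 : {set torus d n} * R := (finset.set0, 0).
have wn (i : 'I_k.+2) : nth c0 s i \in s by rewrite mem_nth// sk.
have /fin_all_exists[x xP] : forall i : 'I_k.+2, exists x, x \in (nth c0 s i).1.
  by move=> i; have [_ /finset.set0Pn] := ws _ (wn i).
have [i [j [ij dist]]] := close_sites (n := n) x d_gt0 (isT : (1 < k.+2)%N).
set c := nth c0 s i in xP; pose c' := nth c0 s j.
have cc' : c != c' by rewrite /c /c' nth_uniq ?sk.
have [cs c's] : c \in s /\ c' \in s by split; exact: wn.
have dcc' := ds _ _ cs c's cc'.
have [cA c_neq0 wc] := ws _ cs; have [c'A c'_neq0 wc'] := ws _ c's.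
have xc : x i \in c.1 by exact: xP.
have xc' : x j \in c'.1 by exact: xP.
have xx : x i != x j by apply: contraTneq xc => ->; rewrite (disjointFl dcc').
rewrite sk in sV.
have [rho [rho01 e1 e2 cost]] := close_escape xx (ltn0Sn _) sV dist.
have [E [W [sE E0 wE leW]]] := weighted_merge_or_drop dcc' wc wc' xc xc' e1 e2 rho01.
pose s' := rem c' (rem c s).
have uc : uniq (rem c s) by exact: rem_uniq.
have us' : uniq s' by exact: rem_uniq.
have mem' a : a \in s' = [&& a != c', a != c & a \in s].
  by rewrite mem_rem_uniq// inE mem_rem_uniq// inE.
have c'r : c' \in rem c s by rewrite mem_rem_uniq// inE eq_sym cc'.
have ps : perm_eq s [:: c, c' & s'].
  by apply: perm_trans (perm_to_rem cs) _; rewrite perm_cons perm_to_rem.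
have dE a : a \in s' -> [disjoint E & a.1]%B.
  rewrite mem' => /and3P[ac' ac as_]; apply: fintype.disjointWl sE _.
  by rewrite finset.disjoints_subset finset.subUset -!finset.disjoints_subset !ds// eq_sym.
have Es' : (E, W) \notin s'.
  by apply: contra E0 => /dE /=; rewrite -finset.setI_eq0 finset.setIid.
have szs' : size s' = k.
  by rewrite /s' size_rem// size_rem// sk.
have [C [W' [CA C0 wC' leW']]] : exists C W', [/\ C \subset A, C != finset.set0, weighted C W' &
    W' <= \prod_(c <- (E, W) :: s') c.2 *
         \prod_(2 <= j < k.+2) expR (merge_cost * Num.sqrt ((n ^ d)%:R / j%:R))].
  apply: IH.
  - by rewrite /= szs'.
  - by rewrite /= szs' ltnW.
  - by rewrite /= Es'.
  - move=> a; rewrite inE => /orP[/eqP->|]; last by rewrite mem' => /and3P[_ _]; exact: ws.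
    by split=> //=; apply: fintype.subset_trans sE _; rewrite finset.subUset cA.
  - move=> a a'; rewrite !inE => /orP[/eqP->|as'] /orP[/eqP->|a's']; rewrite ?eqxx//= => aa'.
    + exact: dE.
    + by rewrite disjoint_sym dE.
    + by apply: ds => //; [move: as'|move: a's']; rewrite mem' => /and3P[].
exists C, W'; split=> //; apply: le_trans leW' _.
rewrite [X in _ <= _ * X]big_nat_recr//=; set G := \prod_(2 <= j < k.+2) _.
rewrite (perm_big _ ps) !big_cons/=; set P := \prod_(_ <- s') _.
have P0 : 0 <= P.
  rewrite /P big_seq; apply: prodr_ge0 => a; rewrite mem' => /and3P[_ _ /ws[_ _]].
  exact: weighted_ge0.
have G0 : 0 <= G by apply: prodr_ge0 => l _; exact: expR_ge0.
have -> (u v w : R) : u * (v * P) * (G * w) = u * v * w * (P * G) by ring.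
rewrite -mulrA ler_wpM2r ?mulr_ge0//; apply: le_trans leW _.
by rewrite ler_wpM2l// mulr_ge0//; exact: weighted_ge0 wc || exact: weighted_ge0 wc'.
Qed.

Lemma sum_inv_sqrt (k : nat) :
  \sum_(1 <= j < k.+1) (Num.sqrt j%:R)^-1 <= 2 * Num.sqrt k%:R :> R.
Proof.
elim: k => [|k IH]; first by rewrite big_geq// sqrtr0 mulr0.
rewrite big_nat_recr//=; apply: le_trans (lerD IH (lexx _)) _.
have a0 : 0 < Num.sqrt k.+1%:R :> R by rewrite sqrtr_gt0.
have b0 : 0 <= Num.sqrt k%:R :> R by exact: sqrtr_ge0.
have a2 : Num.sqrt k.+1%:R ^+ 2 = Num.sqrt k%:R ^+ 2 + 1 :> R.
  by rewrite !sqr_sqrtr// -natr1.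
move: (Num.sqrt _) (Num.sqrt _) a0 b0 a2 => a b a0 b0 a2.
rewrite -lerBrDl -(ler_pM2r a0) mulVf ?gt_eqF//.
have := sqr_ge0 (a - b); rewrite sqrrB; move: a2; rewrite !expr2; lra.
Qed.

Lemma merge_cost_prod (k : nat) : (k <= n ^ d)%N ->
  \prod_(2 <= j < k.+1) expR (merge_cost * Num.sqrt ((n ^ d)%:R / j%:R)) <=
  expR (2 * merge_cost * (n ^ d)%:R) :> R.
Proof.
move=> kV; have mc0 : 0 <= merge_cost.
  by rewrite /merge_cost !addr_ge0// mulr_ge0// exprn_ge0.
case: k kV => [|k] kV; first by rewrite big_geq// -expR0 ler_expR !mulr_ge0.
apply: le_trans (_ : \prod_(1 <= j < k.+2) expR (merge_cost * Num.sqrt ((n ^ d)%:R / j%:R)) <= _).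
  rewrite [leRHS]big_ltn// ler_peMl//; first by apply: prodr_ge0 => i _; exact: expR_ge0.
  by rewrite -expR0 ler_expR mulr_ge0// sqrtr_ge0.
rewrite -expR_sum ler_expR -mulr_sumr (mulrC 2) -!mulrA ler_wpM2l//.
under eq_bigr do rewrite sqrtrM// sqrtrV//.
rewrite -mulr_sumr; apply: le_trans (ler_wpM2l (sqrtr_ge0 _) (sum_inv_sqrt k.+1)) _.
rewrite mulrCA ler_wpM2l// -[leRHS]sqr_sqrtr// expr2 ler_wpM2l ?sqrtr_ge0//.
by rewrite ler_sqrt// ler_nat.
Qed.

(** The bound on the probability of stabilising in a given set [A]: each
    particle contributes a factor [lambda], and the mergers of the clusters of
    [A] cost a factor which is at most exponential in the volume. *)
Lemma settle_dormant_le A M (eta : config d n) : A != finset.set0 ->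
  npart eta = #|A| -> sleepers eta = finset.set0 ->
  settle lambda (dormant A) M eta <=
  M.+1%:R * ((2 * lambda) ^+ #|A| * expR (2 * merge_cost * (n ^ d)%:R)).
Proof.
move=> A0 eN e0; have cA : (0 < #|A|)%N by rewrite card_gt0.
have AV : (#|A| <= n ^ d)%N.
  apply: leq_trans (max_card _) _; rewrite [X in (X <= _)%N](_ : _ = #|{ffun 'I_d -> 'I_n}|)//.
  by rewrite card_ffun !card_ord.
pose s := [seq ([set x]%SET, 2 * lambda) | x <- enum A].
have [C [W [CA C0 [f pot] leW]]] : exists C W, [/\ C \subset A, C != finset.set0, weighted C W &
    W <= \prod_(c <- s) c.2 *
         \prod_(2 <= j < #|A|.-1.+2) expR (merge_cost * Num.sqrt ((n ^ d)%:R / j%:R))].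
  apply: weighted_family.
  - by rewrite size_map -cardE prednK.
  - by rewrite size_map -cardE.
  - by rewrite map_inj_uniq ?enum_uniq// => x y [] /finset.set1_inj.
  - move=> c /mapP[x]; rewrite mem_enum => xA ->; split=> /=.
    + by rewrite finset.sub1set.
    + by apply/finset.set0Pn; exists x; rewrite inE.
    + exists (fun S : {set torus d n} => (x \in S)%:R); rewrite cards1 expr1 mulrAC divff ?mul1r//.
      exact: potential_singleton.
  - move=> c c' /mapP[x _ ->] /mapP[y _ ->] /=.
    by rewrite disjoints1 inE => h; apply: contra h => /eqP->.
have {}leW : W <= (2 * lambda) ^+ #|A| * expR (2 * merge_cost * (n ^ d)%:R).
  apply: le_trans leW _; rewrite /s big_map big_enum prodr_const.
  rewrite ler_wpM2l ?exprn_ge0 ?mulr_ge0 ?(ltW lambda_gt0)//.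
  by rewrite prednK//; exact: merge_cost_prod.
have W0 : 0 <= W by apply: (@weighted_ge0 C); exists f.
have Q0 := potential_ge0 pot.
have leQ : W * 2^-1 ^+ #|C| <= W.
  by rewrite ler_piMr// exprn_ile1// ?invr_ge0// invf_le1// ler1n.
rewrite -addn1 natrD mulrDl mul1r addrC.
apply: le_trans (_ : f (sleepers eta) + M%:R * (W * 2^-1 ^+ #|C|) <= _); last first.
  apply: lerD; last by rewrite ler_wpM2l// (le_trans leQ).
  apply: le_trans (pot_empty pot _) _; first by rewrite e0 finset.set0I.
  exact: le_trans leW.
apply: settle_le_potential => //.
- exact: pot_ge0 pot.
- exact: pot_mono pot.
- by rewrite (pot_full pot).
- move=> S SA; have [SC0|SC] := eqVneq (S :&: C)%SET finset.set0.
    have /finset.set0Pn[x xC] := C0; exists x, x, 0; split.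
    + exact: (fintype.subsetP CA).
    + by apply/negP => xS; have : x \in (S :&: C)%SET; [rewrite inE xS|rewrite SC0 inE].
    + exists (fun=> 0); last by rewrite nbr_avg_cst.
      by split=> // z; rewrite ?lexx ?ler01 ?nbr_avg_cst.
    + by rewrite mul0r add0r; exact: pot_excess pot _ _ SC0 xC.
  have [CS|CS] := boolP (C \subset S).
    have [_ [x xA xS]] := fintype.properP SA; exists x, x, 0; split=> //.
    + exists (fun=> 0); last by rewrite nbr_avg_cst.
      by split=> // z; rewrite ?lexx ?ler01 ?nbr_avg_cst.
    + rewrite (pot_setU1 _ pot) ?subrr ?mulr0 ?mul0r ?add0r//.
      by apply: contra xS; exact: (fintype.subsetP CS).
  have [x [y [r [xC xS yC e st]]]] := pot_step pot SC CS.
  exists x, y, r; split=> //; first exact: (fintype.subsetP CA).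
  by apply: le_trans st _; rewrite lerDl.
- by rewrite e0 finset.sub0set.
Qed.

End Merging.

(** * Stabilising anywhere *)

Section Stabilise.
Context {R : realType} {d n : nat}.
Hypothesis d_gt0 : (0 < d)%N.
Variable lambda : R.
Hypothesis lambda_gt0 : 0 < lambda.
Implicit Types (eta : config d n) (A : {set torus d n}).

Lemma settle_ext (phi psi : config d n -> R) M eta :
  (forall e, (forall x, ~~ active e x) -> npart e = npart eta -> phi e = psi e) ->
  settle lambda phi M eta = settle lambda psi M eta.
Proof.
elim: M eta => [|M IH] eta h; have [[x ax]|st] := stable_dec eta.
- by rewrite !(settle0 _ _ ax).
- by rewrite !settle_stable ?h.
- rewrite !(settle_topple _ _ _ ax); apply: eq_topple => [y|]; apply: IH => e se eN; apply: h => //.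
    by rewrite eN npart_jump.
  by rewrite eN npart_doze.
- by rewrite !settle_stable ?h.
Qed.

Lemma stable_asleep eta : (forall x, ~~ active eta x) -> eta = asleep (sleepers eta).
Proof.
move=> st; apply/ffunP => x; rewrite ffunE inE; move: (st x).
by rewrite activeE negb_and !negbK; case: (eta x) => [k|]//=; case: eqP.
Qed.

Lemma npart_asleep A : npart (asleep A : config d n) = #|A|.
Proof.
rewrite /npart -sum1_card [RHS]big_mkcond; apply: eq_bigr => x _.
by rewrite ffunE; case: ifP.
Qed.

Lemma sleepers_asleep A : sleepers (asleep A : config d n) = A.
Proof. by apply/setP => x; rewrite inE ffunE; case: ifP. Qed.

Lemma settle_split M eta :
  settle lambda (fun=> 1) M eta =
  \sum_(A : {set torus d n} | #|A| == npart eta) settle lambda (dormant A) M eta.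
Proof.
rewrite -big_filter -settle_sum; apply: settle_ext => e se eN.
rewrite big_filter (bigD1 (sleepers e))/=; last first.
  by rewrite -npart_asleep -stable_asleep// eN.
rewrite /dormant -stable_asleep// eqxx big1 ?addr0// => A /andP[_ /negPf Ae].
by case: eqP => // eA; rewrite eA sleepers_asleep eqxx in Ae.
Qed.

Lemma card_torus : #|{: torus d n}| = (n ^ d)%N.
Proof. by rewrite (_ : #|{: torus d n}| = #|{ffun 'I_d -> 'I_n}|)// card_ffun !card_ord. Qed.

Lemma settle_gt_volume M eta : (n ^ d < npart eta)%N -> settle lambda (fun=> 1) M eta = 0.
Proof.
move=> lt; rewrite settle_split big1// => A /eqP cA; exfalso.
by move: lt; rewrite -cA -card_torus ltnNge max_card.
Qed.

(** The number of sets [A] and the cost of the mergers are both exponential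
    in the volume. *)
Lemma settle_le M eta : sleepers eta = finset.set0 ->
  settle lambda (fun=> 1) M eta <= M.+1%:R *
    (expR (2 * @merge_cost R d + 1) ^+ (n ^ d) * (2 * lambda) ^+ npart eta).
Proof.
move=> e0; have mc0 : 0 <= @merge_cost R d.
  by rewrite /merge_cost !addr_ge0// mulr_ge0// exprn_ge0.
have l0 : 0 <= 2 * lambda by rewrite mulr_ge0// ltW.
have [N0|N0] := eqVneq (npart eta) 0%N.
  rewrite N0 expr0 mulr1; apply: le_trans (_ : 1 <= _).
    exact: settle_le1.
  rewrite mulr_ege1// ?ler1n// exprn_ege1// -expR0 ler_expR.
  by rewrite addr_ge0// mulr_ge0.
rewrite settle_split.
apply: le_trans (_ : \sum_(A : {set torus d n} | #|A| == npart eta)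
   M.+1%:R * ((2 * lambda) ^+ npart eta * expR (2 * @merge_cost R d * (n ^ d)%:R)) <= _).
  apply: ler_sum => A /eqP cA; rewrite -cA; apply: settle_dormant_le => //.
  by rewrite -card_gt0 cA lt0n.
rewrite sumr_const -[leLHS]mulr_natr -!mulrA ler_wpM2l// mulrC ler_wpM2r ?exprn_ge0//.
rewrite -expRM_natr [(_ + 1) * _]mulrDl -(mulrA 2) mul1r [leRHS]expRD.
rewrite ler_wpM2l ?expR_ge0//.
apply: le_trans (_ : (2 ^ (n ^ d))%:R <= _).
  rewrite ler_nat; apply: leq_trans (max_card _) _.
  by rewrite -[leqLHS]cardsT -finset.powersetT card_powerset cardsT card_torus.
by rewrite natrX -[(n ^ d)%:R]mul1r expRM_natr lerXn2r ?nnegrE ?expR_ge0//; exact: expR_ge1Dx.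
Qed.

End Stabilise.

(** * Transition functions *)

Section Semigroup.
Context {R : realType} {S : countType}.
Variables (L : (S -> R) -> S -> R) (p : R -> S -> S -> R).
Hypothesis tf : transition_function L p.
Implicit Types (a b c : S) (s t h eps eta : R).

Lemma transition_fin_le1 (r : seq S) t a : uniq r -> 0 <= t ->
  \sum_(b <- r) p t a b <= 1.
Proof.
move=> ur t0; rewrite -lee_fin -(tf_sum1 tf a t0); apply: esum_ge.
exists [set` r]; first by split=> //; exact: finite_seq.
by rewrite -fsbig_seq// sumEFin.
Qed.

Lemma transition_fin_chapman (r : seq S) s t a b : uniq r -> 0 <= s -> 0 <= t ->
  \sum_(c <- r) p s a c * p t c b <= p (s + t) a b.
Proof.
move=> ur s0 t0; rewrite -lee_fin (tf_chapman_kolmogorov tf a b s0 t0); apply: esum_ge.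
exists [set` r]; first by split=> //; exact: finite_seq.
by rewrite -fsbig_seq// sumEFin.
Qed.

Section Drift.
Variables (r : seq S) (g : S -> R) (eps : R).
Hypothesis r_uniq : uniq r.
Hypothesis g_ge0 : forall a, 0 <= g a.
Hypothesis eps_ge0 : 0 <= eps.
Hypothesis drift : forall a, a \in r ->
  - eps <= \sum_(b <- r) g b * L (fun c => (c == b)%:R) a.

Let P t a := \sum_(b <- r) p t a b * g b.

Let P_add s t a : 0 <= s -> 0 <= t -> \sum_(c <- r) p s a c * P t c <= P (s + t) a.
Proof.
move=> s0 t0; under eq_bigr do rewrite /P mulr_sumr.
rewrite exchange_big/=; apply: ler_sum => b _.
under eq_bigr do rewrite mulrA.
by rewrite -mulr_suml ler_wpM2r// transition_fin_chapman.
Qed.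

Let P_small eta : 0 < eta -> exists2 h0 : R, 0 < h0 &
  forall h, 0 < h -> h < h0 -> forall a, a \in r -> g a - (eps + eta) * h <= P h a.
Proof.
move=> eta0.
have one a : a \in r -> \forall h \near 0^'+, g a - (eps + eta) * h <= P h a.
  move=> ar.
  have cv : \sum_(b <- r) (h^-1 * (p h a b - (a == b)%:R)) * g b @[h --> 0^'+] -->
      \sum_(b <- r) L (fun c => (c == b)%:R) a * g b.
    apply: cvg_big; first exact: add_continuous.
    by move=> b _; apply: cvgMl; exact: (tf_rates tf).
  have lt : - (eps + eta) < \sum_(b <- r) L (fun c => (c == b)%:R) a * g b.
    under eq_bigr do rewrite mulrC.
    by apply: lt_le_trans (drift ar); rewrite ltrN2 ltrDl.
  have H : \forall h \near 0^'+,
      - (eps + eta) < \sum_(b <- r) (h^-1 * (p h a b - (a == b)%:R)) * g b.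
    exact: cvgr_gt cv _ lt.
  near=> h.
  have h0 : 0 < h by near: h; exact: nbhs_right_gt.
  have {}lt : - (eps + eta) < \sum_(b <- r) (h^-1 * (p h a b - (a == b)%:R)) * g b.
    by near: h.
  have ga : \sum_(b <- r) (a == b)%:R * g b = g a.
    rewrite (bigD1_seq a)//= eqxx mul1r big1 ?addr0// => b /negPf.
    by rewrite eq_sym => ->; rewrite mul0r.
  have e : \sum_(b <- r) (h^-1 * (p h a b - (a == b)%:R)) * g b = h^-1 * (P h a - g a).
    rewrite -ga /P -sumrB mulr_sumr; apply: eq_bigr => b _.
    by rewrite -mulrA mulrBl.
  move: lt; rewrite e mulrC ltr_pdivlMr// => lt.
  by rewrite -lerBrDl -mulNr ltW.
have : \forall h \near 0^'+, forall a, a \in r -> g a - (eps + eta) * h <= P h a.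
  elim: {-2}r (fun a (ar : a \in r) => ar) => [_|b l IH sub]; first exact: nearW.
  have hb := one b (sub b (mem_head _ _)).
  have hl := IH (fun a al => sub a (mem_behead (s := b :: l) al)).
  near=> h.
  have Hb : g b - (eps + eta) * h <= P h b by near: h.
  have Hl : forall a, a \in l -> g a - (eps + eta) * h <= P h a by near: h.
  by move=> a; rewrite inE => /orP[/eqP->//|]; exact: Hl.
rewrite /at_right => /nbhs_ballP[h0 /= h00 H]; exists h0 => // h h_gt0 hh0.
by apply: H => //=; rewrite /ball/= sub0r normrN gtr0_norm.
Unshelve. all: by end_near. Qed.

Let P0 a : a \in r -> g a <= P 0 a.
Proof.
move=> ar; rewrite /P (bigD1_seq a)//= (tf_0 tf) eqxx mul1r lerDl sumr_ge0// => b _.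
by rewrite mulr_ge0// (tf_ge0 tf).
Qed.

Let P_iter eta h (m : nat) a : 0 <= eta -> 0 <= h ->
  (forall c, c \in r -> g c - (eps + eta) * h <= P h c) -> a \in r ->
  g a - (eps + eta) * (h * m%:R) <= P (h * m%:R) a.
Proof.
move=> eta0 h0 H; elim: m => [|m IH] ar.
  by rewrite !mulr0 subr0 P0.
have hm0 : 0 <= h * m%:R by rewrite mulr_ge0.
rewrite -natr1 mulrDr mulr1; apply: le_trans (P_add a hm0 h0).
apply: le_trans (_ : \sum_(c <- r) p (h * m%:R) a c * (g c - (eps + eta) * h) <= _); last first.
  by rewrite !big_seq; apply: ler_sum => c cr; rewrite ler_wpM2l ?(tf_ge0 tf)// H.
under eq_bigr do rewrite mulrBr.
rewrite sumrB -mulr_suml mulrDr opprD addrA; apply: lerB; first exact: IH.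
rewrite ler_piMl// ?transition_fin_le1// mulr_ge0// addr_ge0//.
Qed.

(** A function which is [0] off a finite set of states and decreases at most at
    rate [eps] along the generator decreases at most at rate [eps] along the
    semigroup. The finite set need not be absorbing a priori: mass which leaves
    it is only lost in the sums below, and this is taken care of by iterating
    the estimate over small time steps. *)
Lemma transition_drift t a : 0 <= t -> a \in r ->
  g a - eps * t <= \sum_(b <- r) p t a b * g b.
Proof.
move=> t0 ar; have [->|tn0] := eqVneq t 0.
  by rewrite mulr0 subr0; exact: P0.
have {tn0}t0' : 0 < t by rewrite lt0r tn0.
apply/ler_addgt0Pr => e e0; have et0 : 0 < e / t by rewrite divr_gt0.
have [h0 h00 H] := P_small et0.
have [m mP] : exists m : nat, t / m.+1%:R < h0.
  have [m tm] := ltr_add_invr (y := 0) (x := h0 / t) (divr_gt0 h00 t0').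
  by exists m; move: tm; rewrite add0r ltr_pdivlMr// mulrC.
have tm : t / m.+1%:R * m.+1%:R = t by rewrite divfK.
have h0' : 0 < t / m.+1%:R by rewrite divr_gt0.
have := P_iter m.+1 (ltW et0) (ltW h0') (H _ h0' mP) ar.
by rewrite tm mulrDl divfK ?gt_eqF// opprD addrA lerBlDr.
Qed.

End Drift.
End Semigroup.

(** * Transition probabilities of activated random walks *)

Section ArwTransition.
Context {R : realType} {d n : nat}.
Hypothesis d_gt0 : (0 < d)%N.
Variable lambda : R.
Hypothesis lambda_gt0 : 0 < lambda.
Implicit Types (a b e : config d n) (g phi : config d n -> R).

Definition stableb e : bool := [forall x, ~~ active e x].

Lemma stablebP e : reflect (stable e) (stableb e).
Proof.
apply: (iffP forallP) => st x; first by move: (st x); rewrite /active lt0n negbK => /eqP.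
by rewrite /active lt0n negbK; exact/eqP/st.
Qed.

Lemma generator_sum (I : Type) (r : seq I) (c : I -> R) (F : I -> config d n -> R) e :
  arw_generator lambda (fun a => \sum_(i <- r) c i * F i a) e =
  \sum_(i <- r) c i * arw_generator lambda (F i) e.
Proof.
under eq_bigr do rewrite arw_generatorE// mulr_sumr.
rewrite arw_generatorE// exchange_big/=; apply: eq_bigr => x _.
rewrite topple_sum -sumrB mulr_sumr; apply: eq_bigr => i _.
by rewrite /topple nbr_avgZ; ring.
Qed.

Lemma eq_generator g phi e : g e = phi e ->
  (forall x y, active e x -> g (jump e x y) = phi (jump e x y)) ->
  (forall x, active e x -> g (doze e x) = phi (doze e x)) ->
  arw_generator lambda g e = arw_generator lambda phi e.
Proof.
move=> ge gj gs; rewrite !arw_generatorE//; apply: eq_bigr => x ax.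
by rewrite ge; congr (_ * (_ - _)); apply: eq_topple => [y|]; [exact: gj|exact: gs].
Qed.

Lemma total_rate_le e :
  \sum_(x | active e x) (nb_active e x)%:R * (1 + lambda) <= (npart e)%:R * (1 + lambda).
Proof.
rewrite -mulr_suml ler_wpM2r ?addr_ge0 ?(ltW lambda_gt0)//.
rewrite /npart natr_sum [leRHS](bigID (active e))/= -[leLHS]addr0 lerD ?sumr_ge0//.
by apply: ler_sum => x _; rewrite ler_nat /nb_active; case: (e x).
Qed.

Lemma npart_enum (N : nat) : exists r : seq (config d n),
  uniq r /\ forall e, (e \in r) = (npart e == N).
Proof.
pose c (f : {ffun torus d n -> option 'I_N.+1}) : config d n :=
  [ffun x => omap (@nat_of_ord _) (f x)].
exists (undup [seq e <- map c (enum {: {ffun torus d n -> option 'I_N.+1}}) | npart e == N]).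
split=> [|e]; first exact: undup_uniq.
rewrite mem_undup mem_filter; case: eqP => //= eN.
apply/mapP; exists [ffun x => omap inord (e x)]; first by rewrite mem_enum.
apply/ffunP => x; rewrite !ffunE; case ex : (e x) => [k|]//=.
rewrite inordK// ltnS -eN /npart (bigD1 x)//= ex; exact: leq_addr.
Qed.

Section Transition.
Variable p : R -> config d n -> config d n -> R.
Hypothesis tf : transition_function (arw_generator lambda) p.

Lemma stable_absorbing t b : 0 <= t -> stable b -> 1 <= p t b b.
Proof.
move=> t0 /stablebP/forallP st.
have := transition_drift tf (r := [:: b]) (g := fun=> 1) (eps := 0) isT (fun=> ler01) (lexx 0) _ t0 (mem_head _ _).
rewrite big_seq1 mul0r subr0 mulr1; apply.
move=> a; rewrite inE => /eqP->; rewrite big_seq1 mul1r arw_generatorE// big1 ?oppr0// => x ax.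
by rewrite (negPf (st x)) in ax.
Qed.

(** The average of [settle 1 i] for [i < M] increases along the generator at
    rate at most [n ^ d * (1 + lambda) / M] only, because the sum of the
    increments of [settle 1 i] in [i] is telescoping. *)
Lemma unstable_transition (M : nat) t a : (0 < M)%N -> 0 <= t ->
  exists r : seq (config d n), uniq r /\
    1 - (settle lambda (fun=> 1) M a + (n ^ d)%:R * (1 + lambda) / M%:R * t) <=
    \sum_(b <- r | ~~ stableb b) p t a b.
Proof.
move=> M0 t0; have [r [ur rP]] := npart_enum (npart a); exists r; split=> //.
have ar : a \in r by rewrite rP.
have M0R : 0 < M%:R :> R by rewrite ltr0n.
pose G e := M%:R^-1 * \sum_(i < M) settle lambda (fun=> 1) i e.
have one_ge0 (e : config d n) : 0 <= 1 :> R by [].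
have settle_mono i e : (i <= M)%N -> settle lambda (fun=> 1) i e <= settle lambda (fun=> 1) M e.
  move=> iM; elim: M iM {M0 M0R G} => [|M' IH]; first by rewrite leqn0 => /eqP->.
  rewrite leq_eqVlt => /orP[/eqP->//|]; rewrite ltnS => /IH h.
  exact: le_trans h (settle_leS d_gt0 lambda_gt0 _ _ one_ge0).
have G_le e : G e <= settle lambda (fun=> 1) M e.
  rewrite /G ler_pdivrMl// mulr_natl -[M in _ *+ M]card_ord -sumr_const.
  by apply: ler_sum => i _; apply: settle_mono; exact: ltnW.
have settle1 i e : settle lambda (fun=> 1) i e <= 1 by exact: settle_le1.
have G1 e : G e <= 1 by exact: le_trans (G_le e) _.
have G0 e : 0 <= G e.
  by rewrite mulr_ge0 ?invr_ge0 ?ler0n// sumr_ge0// => i _; exact: settle_ge0.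
have Gst e : stableb e -> G e = 1.
  move/forallP => st; rewrite /G (eq_bigr (fun=> 1)); last by move=> i _; rewrite settle_stable.
  by rewrite sumr_const card_ord mulVf// gt_eqF.
set eps := (n ^ d)%:R * (1 + lambda) / M%:R.
have eps0 : 0 <= eps by rewrite divr_ge0// mulr_ge0// addr_ge0// ltW.
have drift e : e \in r -> - eps <=
    \sum_(b <- r) (1 - G b) * arw_generator lambda (fun c => (c == b)%:R) e.
  rewrite rP => /eqP eN; rewrite -generator_sum.
  have restrict c : npart c = npart a -> \sum_(b <- r) (1 - G b) * (c == b)%:R = 1 - G c.
    move=> cN; rewrite (bigD1_seq c)/= ?rP ?cN// eqxx mulr1 big1 ?addr0// => b /negPf.
    by rewrite eq_sym => ->; rewrite mulr0.
  have -> : arw_generator lambda (fun c => \sum_(b <- r) (1 - G b) * (c == b)%:R) e =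
      arw_generator lambda (fun c => \sum_(i <- [:: false; true])
        (if i then -1 else 1) * (if i then G c else 1)) e.
    have eqG c : 1 - G c = \sum_(i <- [:: false; true])
        (if i then -1 else 1) * (if i then G c else 1).
      by rewrite big_cons big_seq1/= mul1r mulN1r.
    apply: eq_generator => [|x y ax|x ax]; rewrite restrict ?eqG//.
      by rewrite npart_jump.
    by rewrite npart_doze.
  rewrite (generator_sum [:: false; true] (fun i : bool => if i then -1 else 1)
    (fun (i : bool) c => if i then G c else 1)) big_cons big_seq1/= mul1r mulN1r.
  have -> : arw_generator lambda (fun=> 1) e = 0.
    by rewrite arw_generatorE// big1// => x _; rewrite topple_cst// subrr mulr0.
  rewrite add0r lerN2.
  have -> : arw_generator lambda G e = M%:R^-1 *
     ((\sum_(x | active e x) (nb_active e x)%:R * (1 + lambda)) *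
      (settle lambda (fun=> 1) M e - settle lambda (fun=> 1) 0 e)).
    transitivity (arw_generator lambda (fun c => \sum_(i <- index_enum 'I_M)
        M%:R^-1 * settle lambda (fun=> 1) i c) e).
      by congr (arw_generator lambda _ e); apply/funext => c; rewrite /G mulr_sumr.
    rewrite (generator_sum _ (fun=> M%:R^-1) (fun (i : 'I_M) => settle lambda (fun=> 1) i)).
    rewrite -mulr_sumr; congr (_ * _).
    under eq_bigr do rewrite generator_settle//.
    rewrite -mulr_sumr -(big_mkord xpredT (fun i =>
      settle lambda (fun=> 1) i.+1 e - settle lambda (fun=> 1) i e)).
    by rewrite telescope_sumr.
  rewrite mulrC ler_wpM2r ?invr_ge0//.
  have s0 : 0 <= settle lambda (fun=> 1) 0 e by exact: settle_ge0.
  have l1 : 0 <= 1 + lambda by rewrite addr_ge0// ltW.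
  have [big|small] := ltnP (n ^ d) (npart e).
    rewrite !settle_gt_volume// subrr mulr0 mulr_ge0//.
  rewrite -[leRHS]mulr1; apply: ler_pM.
  - by apply: sumr_ge0 => x _; rewrite mulr_ge0.
  - by rewrite subr_ge0 settle_mono.
  - by apply: le_trans (total_rate_le e) _; rewrite ler_wpM2r// ler_nat.
  - by rewrite lerBlDr; apply: le_trans (settle1 M e) _; rewrite lerDl.
have main := transition_drift tf ur (g := fun b => 1 - G b)
  (fun b => etrans (subr_ge0 _ _) (G1 b)) eps0 drift t0 ar.
apply: le_trans (_ : 1 - G a - eps * t <= _).
  by rewrite opprD addrA lerD2r lerD2l lerN2.
apply: le_trans main _; rewrite [leRHS]big_mkcond/= big_seq [leRHS]big_seq.
apply: ler_sum => b br; have pb := tf_ge0 tf a b t0.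
case: ifPn => [_|]; last by rewrite negbK => /Gst->; rewrite subrr mulr0.
by rewrite ler_piMr// gerBl.
Qed.

End Transition.
End ArwTransition.

(** * From transition probabilities to the fixation time *)

Section CountableUnion.
Context {R : realType} (dO : measure_display) (Omega : measurableType dO)
  (P : probability Omega R) {T : countType}.
Implicit Type F : T -> set Omega.

Definition enum_sets F (k : nat) : set Omega :=
  if pickle_inv k is Some a then F a else set0.

Lemma bigcup_enum_sets F : \bigcup_k enum_sets F k = \bigcup_a F a.
Proof.
apply/seteqP; split=> [w [k _]|w [a _ Faw]].
  by rewrite /enum_sets; case: (pickle_inv k) => // a Faw; exists a.
by exists (pickle a) => //; rewrite /enum_sets pickleK_inv.
Qed.

Lemma measurable_enum_sets F : (forall a, measurable (F a)) ->
  forall k, measurable (enum_sets F k).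
Proof. by move=> mF k; rewrite /enum_sets; case: (pickle_inv k). Qed.

Lemma measurable_bigcup_countable F : (forall a, measurable (F a)) ->
  measurable (\bigcup_a F a).
Proof.
move=> mF; rewrite -bigcup_enum_sets; apply: bigcup_measurable => k _.
exact: measurable_enum_sets.
Qed.

Lemma countable_subadditive F (A : set Omega) (B : R) :
  (forall a, measurable (F a)) -> measurable A -> A `<=` \bigcup_a F a ->
  (forall s : seq T, uniq s -> (\sum_(a <- s) P (F a) <= B%:E)%E) ->
  (P A <= B%:E)%E.
Proof.
move=> mF mA; rewrite -bigcup_enum_sets => AF FB.
apply: (le_trans (@measure_sigma_subadditive _ _ _ P A (enum_sets F)
  (measurable_enum_sets mF) mA AF)).
apply: lime_le; first by apply: is_cvg_nneseries => k _ _; exact: measure_ge0.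
apply: nearW => K.
rewrite (_ : (\sum_(0 <= k < K) P (enum_sets F k))%E =
             (\sum_(a <- pmap (@pickle_inv T) (iota 0 K)) P (F a))%E).
  by apply: FB; apply: pmap_uniq (@pickle_invK T) _ (iota_uniq _ _).
rewrite /index_iota subn0; elim: (iota 0 K) => [|k l IH]; first by rewrite !big_nil.
rewrite big_cons IH /enum_sets /=; case: (pickle_inv k) => [a|] /=.
  by rewrite big_cons.
by rewrite measure0 add0e.
Qed.

End CountableUnion.

Section Marginals.
Context {R : realType} {S : countType}.
Variables (L : (S -> R) -> S -> R) (nu : S -> R).
Context (dO : measure_display) (Omega : measurableType dO) (P : probability Omega R).
Variables (X : R -> Omega -> S) (p : R -> S -> S -> R).
Hypothesis mX : forall t a, 0 <= t -> measurable [set w | X t w = a].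
Hypothesis law : forall m (t : nat -> R) (a : nat -> S),
  t 0%N = 0 -> (forall i, t i <= t i.+1) ->
  P (\bigcap_(i in [set i : nat | (i <= m)%N]) [set w | X (t i) w = a i]) =
  (nu (a 0%N) * \prod_(i < m) p (t i.+1 - t i) (a i) (a i.+1))%:E.

Lemma law_init a : P [set w | X 0 w = a] = (nu a)%:E.
Proof.
have := law 0 (fun=> a) (erefl ((fun=> 0) 0%N)) (fun=> lexx 0).
rewrite big_ord0 mulr1 => <-; congr (P _); apply/seteqP; split=> [w Xw i _//|w].
by apply; exact: leqnn.
Qed.

Lemma law_pair a b t : 0 <= t ->
  P ([set w | X 0 w = a] `&` [set w | X t w = b]) = (nu a * p t a b)%:E.
Proof.
move=> t0; pose ti (i : nat) := if i is 0%N then 0 else t.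
pose ai (i : nat) := if i is 0%N then a else b.
have := law 1 (t := ti) ai (erefl _); rewrite big_ord_recl big_ord0 mulr1 /= subr0 => <-.
  congr (P _); apply/seteqP; split=> [w [Xa Xb] [|[|i]]//|w Xw].
  by split; [exact: (Xw 0%N)|exact: (Xw 1%N)].
by case.
Qed.

Lemma law_triple a b c s t : 0 <= s -> s <= t ->
  P ([set w | X 0 w = a] `&` [set w | X s w = b] `&` [set w | X t w = c]) =
  (nu a * (p s a b * p (t - s) b c))%:E.
Proof.
move=> s0 st; pose ti (i : nat) := match i with 0%N => 0 | 1%N => s | _ => t end.
pose ai (i : nat) := match i with 0%N => a | 1%N => b | _ => c end.
have := law 2 (t := ti) ai (erefl _).
rewrite 2!big_ord_recl big_ord0 mulr1 /= subr0 => <-.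
  congr (P _); apply/seteqP; split=> [w [[Xa Xb] Xc] [|[|[|i]]]//|w Xw].
  by split; [split; [exact: (Xw 0%N)|exact: (Xw 1%N)]|exact: (Xw 2%N)].
by do 2?case.
Qed.

Lemma measurable_state t (A : set S) : 0 <= t -> measurable [set w | A (X t w)].
Proof.
move=> t0; rewrite (_ : [set w | A (X t w)] =
    \bigcup_a (if `[< A a >] then [set w | X t w = a] else set0)).
  by apply: measurable_bigcup_countable => a; case: ifP => // _; exact: mX.
apply/seteqP; split=> [w /= Aw|w [a _]].
  by exists (X t w) => //; rewrite asboolT.
by case: ifP => // /asboolP Aa /= ->.
Qed.

End Marginals.

Section Fixation.
Context {R : realType} {d n : nat}.
Hypothesis d_gt0 : (0 < d)%N.
Variables (lambda mu : R).
Hypothesis lambda_gt0 : 0 < lambda.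
Context (dO : measure_display) (Omega : measurableType dO) (P : probability Omega R).
Variable X : R -> Omega -> config d n.
Hypothesis HX : arw mu lambda P X.
Implicit Types (a b : config d n) (t tau : R).

Let mX := mp_measurable HX.
Let nu : config d n -> R := arw_initial_law mu.

Definition fixed_at t : set Omega := [set w | stable (X t w)].

Lemma measurable_fixed_at t : 0 <= t -> measurable (fixed_at t).
Proof. by move=> t0; exact: (measurable_state mX (@stable d n) t0). Qed.

Lemma fixation_time_lt tau : [set w | (fixation_time X w < tau%:E)%E] =
  \bigcup_(q : rat) (if (0 <= (ratr q : R)) && (ratr q < tau) then fixed_at (ratr q) else set0).
Proof.
apply/seteqP; split=> [w /= /ereal_inf_lt[_ [t [t0 st] <-]]|w [q _]].
  rewrite lte_fin => ttau.
  have [e e0 He] : exists2 e : R, 0 < e & forall s, t < s -> s < t + e -> X s w = X t w.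
    have := mp_right_continuous HX w t0; rewrite /at_right => /nbhs_ballP[e /= e0 H].
    exists e => // s ts ste; apply: H => //=.
    by rewrite /ball/= distrC gtr0_norm ?subr_gt0// ltrBlDl.
  have [q] : exists q, ratr q \in `]t, (Num.min tau (t + e))[%R.
    by apply: rat_in_itvoo; rewrite lt_min ttau ltrDl.
  rewrite in_itv/= lt_min => /and3P[tq qtau qe].
  exists q => //; rewrite qtau (le_trans t0 (ltW tq))/=.
  by rewrite /fixed_at/= He.
case: ifP => // /andP[q0 qtau] st; apply: le_lt_trans (_ : ((ratr q)%:E < tau%:E)%E).
  by apply: ereal_inf_lbound; exists (ratr q).
by rewrite lte_fin.
Qed.

Let measurable_fixation tau : measurable [set w | (fixation_time X w < tau%:E)%E].
Proof.
rewrite fixation_time_lt; apply: measurable_bigcup_countable => q.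
by case: ifP => // /andP[q0 _]; exact: measurable_fixed_at.
Qed.

(** By right-continuity the fixation time is less than [tau] if the process is
    stable at some rational time before [tau]; as stable configurations are
    absorbing, it is then stable at time [tau] almost surely. *)
Lemma fixation_le_fixed tau : 0 <= tau ->
  (P [set w | (fixation_time X w < tau%:E)%E] <= P (fixed_at tau))%E.
Proof.
move=> tau0; have [p tf law] := mp_law HX.
have mf := measurable_fixed_at tau0.
set A := [set w | _].
pose N (i : rat * config d n * config d n) : set Omega :=
  if [&& 0 <= (ratr i.1.1 : R), ratr i.1.1 < tau & stableb i.2]
  then ([set w | X 0 w = i.1.2] `&` [set w | X (ratr i.1.1) w = i.2]) `\` [set w | X tau w = i.2]
  else set0.
have mN i : measurable (N i).
  rewrite /N; case: ifP => // /and3P[q0 _ _].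
  by apply: measurableD; [apply: measurableI; apply: mX|exact: mX].
have N0 i : P (N i) = 0%E.
  rewrite /N; case: ifP; last by rewrite measure0.
  case: i => [[q a] b] /= /and3P[q0 qtau /stablebP st].
  have mab : measurable ([set w | X 0 w = a] `&` [set w | X (ratr q) w = b]).
    by apply: measurableI; exact: mX.
  apply/eqP; rewrite eq_le measure_ge0 andbT measureD//; last 2 first.
  - exact: mX.
  - by apply: le_lt_trans (probability_le1 _ _) _; rewrite ?ltry.
  have e2 := law_pair law a b q0; have e3 := law_triple law a b b q0 (ltW qtau).
  apply: (@le_trans _ _ ((nu a * p (ratr q) a b)%:E -
      (nu a * (p (ratr q) a b * p (tau - ratr q) b b))%:E)%E).
    by rewrite /nu -e2 -e3.
  rewrite -EFinB lee_fin subr_le0 ler_wpM2l//.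
    by rewrite -lee_fin -(law_init law).
  by rewrite ler_peMr ?(tf_ge0 tf)// (stable_absorbing d_gt0 lambda_gt0 tf)// subr_ge0 ltW.
have sub : A `<=` fixed_at tau `|` \bigcup_i N i.
  rewrite /A fixation_time_lt => w [q _]; case: ifP => // /andP[q0 qtau] st.
  have [e|ne] := eqVneq (X tau w) (X (ratr q) w); first by left; rewrite /fixed_at /= e.
  right; exists (q, X 0 w, X (ratr q) w) => //.
  rewrite /N /= q0 qtau (introT (stablebP _) st); split=> //=.
  exact/eqP.
have mUN : measurable (\bigcup_i N i) by exact: measurable_bigcup_countable.
apply: le_trans (_ : P (fixed_at tau `|` \bigcup_i N i) <= _)%E.
  apply: le_measure; rewrite ?inE//; first exact: measurable_fixation.
  exact: measurableU.
apply: (le_trans (measureU2 _ mf mUN)).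
rewrite -[leRHS]adde0 leeD2l//.
by apply: (countable_subadditive mN mUN) => // s _; rewrite big1.
Qed.

(** [unstable_transition] bounds from below the mass of finitely many unstable
    configurations, and the rest bounds the mass of the stable ones. *)
Lemma fixed_from_le (M : nat) t a : (0 < M)%N -> 0 <= t ->
  (P ([set w | X 0 w = a] `&` fixed_at t) <=
   (nu a * Num.min 1 (settle lambda (fun=> 1) M a +
                       (n ^ d)%:R * (1 + lambda) / M%:R * t))%:E)%E.
Proof.
move=> M0 t0; have [p tf law] := mp_law HX.
have [r [ur lower]] := unstable_transition d_gt0 lambda_gt0 tf a M0 t0.
have ma := mX a (lexx 0); have mf := measurable_fixed_at t0.
have nu0 : 0 <= nu a by rewrite -lee_fin -(law_init law).
rewrite minr_pMr// mulr1 EFin_min le_min.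
rewrite -{1}(law_init law) le_measure ?inE//=; last exact: measurableI.
set E := [set w | X 0 w = a] `&` fixed_at t.
pose D := [set` [seq b <- r | ~~ stableb b]].
pose U := \bigcup_(b in D) ([set w | X 0 w = a] `&` [set w | X t w = b]).
have mb b : measurable ([set w | X 0 w = a] `&` [set w | X t w = b]).
  by apply: measurableI; exact: mX.
have finD : finite_set D by exact: finite_seq.
have mU : measurable U by exact: fin_bigcup_measurable.
have PU : P U = (nu a * \sum_(b <- r | ~~ stableb b) p t a b)%:E.
  rewrite /U measure_fin_bigcup//.
    rewrite -fsbig_seq ?filter_uniq// big_filter mulr_sumr -sumEFin.
    by apply: eq_bigr => b _; exact: (law_pair law).
  by move=> b c _ _ [w [[_ /= <-] [_ /= <-]]].
have EU : E `&` U = set0.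
  apply/seteqP; split=> // w [[_ st] [b]]; rewrite /D /= mem_filter => /andP[ub _] [_ /= Xb].
  by move: st; rewrite /fixed_at/= Xb => /stablebP; rewrite (negPf ub).
have mE : measurable E by exact: measurableI.
have : (P E + P U <= (nu a)%:E)%E.
  rewrite -measureU// -(law_init law); apply: le_measure; rewrite ?inE//.
    exact: measurableU.
  by move=> w [[]//|[b _ []]].
rewrite PU -leeBrDr// -EFinB => /le_trans; apply.
rewrite lee_fin -[X in X - _]mulr1 -mulrBr ler_wpM2l//.
by rewrite lerBlDr -lerBlDl.
Qed.

End Fixation.

(** * Poisson initial configurations *)

Section Poisson.
Context {R : realType} {d n : nat}.
Variable mu : R.
Hypothesis mu_gt0 : 0 < mu.
Implicit Types (a : config d n).

Lemma expR_ge_partial_sum (x : R) (K : nat) : 0 <= x ->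
  \sum_(k < K) x ^+ k / k`!%:R <= expR x.
Proof.
move=> x0; rewrite /expR.
have -> : \sum_(k < K) x ^+ k / k`!%:R = series (exp_coeff x) K by rewrite /series /= big_mkord.
apply: nondecreasing_cvgn_le; last exact: is_cvg_series_exp_coeff.
apply/nondecreasing_seqP => k; rewrite /series /= big_nat_recr//= lerDl.
by rewrite /exp_coeff /= divr_ge0// exprn_ge0.
Qed.

Lemma poisson_partial_sum (z : R) (K : nat) : 0 <= z ->
  \sum_(k < K) poisson_pmf mu k * z ^+ k <= expR (- (mu * (1 - z))).
Proof.
move=> z0; have -> : - (mu * (1 - z)) = mu * z + - mu by ring.
have mz : 0 <= mu * z by rewrite mulr_ge0// ltW.
rewrite expRD; apply: le_trans (ler_wpM2r (expR_ge0 _) (expR_ge_partial_sum K mz)).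
rewrite mulr_suml; apply: ler_sum => k _; rewrite /poisson_pmf mu_gt0 exprMn.
by rewrite le_eqVlt; apply/orP; left; apply/eqP; ring.
Qed.

Lemma ler_sum_sub (T : eqType) (s t : seq T) (F : T -> R) : uniq s -> uniq t ->
  {subset s <= t} -> (forall x, 0 <= F x) -> \sum_(x <- s) F x <= \sum_(x <- t) F x.
Proof.
move=> us ut st F0; rewrite [leRHS](bigID (mem s))/= -[leLHS]addr0 lerD ?sumr_ge0//.
have pm : perm_eq s [seq x <- t | x \in s].
  apply: uniq_perm; rewrite ?filter_uniq// => x.
  by rewrite mem_filter; case: (boolP (x \in s)) => // /st ->.
by rewrite (perm_big _ pm)/= big_filter.
Qed.

(** A finite set of configurations takes finitely many values at each site, so
    that its sum is at most a finite product of finite sums. *)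
Lemma sum_config_le (g : nat -> R) (c : R) (s : seq (config d n)) : uniq s ->
  (forall k, 0 <= g k) -> (forall K, \sum_(k < K) g k <= c) ->
  \sum_(a <- s) \prod_x (if a x is Some k then g k else 0) <= c ^+ (n ^ d).
Proof.
move=> us g0 gc; pose F a := \prod_x (if a x is Some k then g k else 0).
have F0 a : 0 <= F a by apply: prodr_ge0 => x _; case: (a x).
pose K := (\max_(a <- s) npart a).+1.
pose e (f : {ffun torus d n -> 'I_K}) : config d n := [ffun x => Some (f x : nat)].
have e_inj : injective e.
  move=> f f' /ffunP ff'; apply/ffunP => x; apply: val_inj.
  by have := ff' x; rewrite !ffunE => -[].
pose full a := [forall x, a x != None].
rewrite (bigID full)/= [X in _ + X]big1 ?addr0; last first.
  move=> a /forallPn[x]; rewrite negbK => /eqP ax.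
  by rewrite (bigD1 x)//= ax mul0r.
rewrite -big_filter; apply: le_trans (_ : \sum_(a <- map e (enum {: {ffun torus d n -> 'I_K}})) F a <= _).
  apply: ler_sum_sub => //; first exact: filter_uniq.
    by rewrite (map_inj_uniq e_inj); exact: enum_uniq.
  move=> a.
  rewrite mem_filter => /andP[/forallP fa as_]; apply/mapP.
  exists [ffun x => inord (nb_active a x)]; first by rewrite mem_enum.
  apply/ffunP => x; rewrite !ffunE /nb_active; case ax : (a x) (fa x) => [k|]// _.
  rewrite inordK// ltnS; apply: leq_trans (leq_bigmax_seq _ as_ isT).
  by rewrite /npart (bigD1 x)//= ax leq_addr.
rewrite big_map big_enum/= (eq_bigr (fun f : {ffun torus d n -> 'I_K} => \prod_x g (f x))).
  rewrite -(bigA_distr_bigA (fun (x : torus d n) (k : 'I_K) => g k)) prodr_const.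
  by rewrite -card_torus lerXn2r ?nnegrE ?sumr_ge0// (le_trans _ (gc 0%N))// big_ord0.
by move=> f _; apply: eq_bigr => x _; rewrite ffunE.
Qed.

Lemma arw_initial_law_ge0 a : 0 <= arw_initial_law mu a.
Proof. by apply: prodr_ge0 => x _; case: (a x) => // k; exact: poisson_pmf_ge0. Qed.

Lemma arw_initial_law_sleepers a : sleepers a != finset.set0 -> arw_initial_law mu a = 0.
Proof.
case/finset.set0Pn => x; rewrite inE => /eqP ax.
by rewrite /arw_initial_law (bigD1 x)//= ax mul0r.
Qed.

(** By independence of the sites, the generating function of the number of
    particles is a power of the one of a Poisson variable. *)
Lemma poisson_generating (z : R) (s : seq (config d n)) : 0 <= z -> uniq s ->
  \sum_(a <- s) arw_initial_law mu a * z ^+ npart a <= expR (- (mu * (1 - z))) ^+ (n ^ d).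
Proof.
move=> z0 us; rewrite (eq_bigr (fun a => \prod_x
    (if a x is Some k then poisson_pmf mu k * z ^+ k else 0))).
  apply: (sum_config_le (g := fun k => poisson_pmf mu k * z ^+ k)) => // [k|K].
    by rewrite mulr_ge0 ?poisson_pmf_ge0 ?exprn_ge0.
  exact: poisson_partial_sum.
move=> a _; rewrite /npart expr_sum -big_split/=; apply: eq_bigr => x _.
by case: (a x) => // ; rewrite mul0r.
Qed.

End Poisson.

Section Fixed.
Context {R : realType} {d n : nat}.
Hypothesis d_gt0 : (0 < d)%N.
Variables (lambda mu : R).
Hypothesis lambda_gt0 : 0 < lambda.
Hypothesis mu_gt0 : 0 < mu.
Context (dO : measure_display) (Omega : measurableType dO) (P : probability Omega R).
Variable X : R -> Omega -> config d n.
Hypothesis HX : arw mu lambda P X.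

Lemma expR_mulrn (x : R) k : expR (x *+ k) = expR x ^+ k.
Proof. by rewrite -mulr_natl expRM_natl. Qed.

Lemma min1_expR_le (s y : R) : 0 <= s <= 1 -> Num.min 1 (expR y) <= expR (s * y).
Proof.
case/andP=> s0 s1; rewrite ge_min; have [y0|y0] := leP y 0.
  by rewrite ler_expR orbC -[leLHS]mul1r ler_wnM2r.
by rewrite -expR0 ler_expR mulr_ge0// ltW.
Qed.

(** The exponent [s] makes the average over the number [N] of particles of
    order [exp (s * y)], where the bound [exp y] of [settle_le] is evaluated
    for [N = mu * n ^ d]: taking [s] small is what handles the fluctuations of
    [N], in particular the values for which [exp y] exceeds [1]. *)
Lemma fixed_le (M : nat) (s A t : R) : (0 < M)%N -> 0 <= t -> 0 <= s <= 1 ->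
  M.+1%:R <= expR A ->
  (P (fixed_at X t) <= (expR (s * (A + (2 * @merge_cost R d + 1) *+ n ^ d)
       - (mu * (1 - expR (s * ln (2 * lambda)))) *+ n ^ d) +
     (n ^ d)%:R * (1 + lambda) / M%:R * t)%:E)%E.
Proof.
move=> M0 t0 s01 MA; set z := expR (s * ln _); set eps := _ / M%:R * t.
have eps0 : 0 <= eps.
  by rewrite /eps mulr_ge0// divr_ge0// mulr_ge0// addr_ge0// ltW.
set c1 := 2 * _ + 1.
apply: (countable_subadditive (F := fun a => [set w | X 0 w = a] `&` fixed_at X t)).
- move=> a; apply: measurableI; first exact: (mp_measurable HX a (lexx 0)).
  exact: (measurable_fixed_at HX t0).
- exact: (measurable_fixed_at HX t0).
- by move=> w st; exists (X 0 w).
move=> r ur; apply: le_trans (_ : (\sum_(a <- r) (arw_initial_law mu a *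
    (expR (s * (A + c1 *+ n ^ d)) * z ^+ npart a + eps))%:E <= _))%E.
  apply: lee_sum => a _; apply: le_trans (fixed_from_le d_gt0 lambda_gt0 HX a M0 t0) _.
  rewrite lee_fin; have [e0|/(arw_initial_law_sleepers mu) ->] := eqVneq (sleepers a) finset.set0;
    last by rewrite !mul0r.
  rewrite ler_wpM2l ?arw_initial_law_ge0//.
  set y := A + c1 *+ n ^ d + ln (2 * lambda) *+ npart a.
  have yle : settle lambda (fun=> 1) M a <= expR y.
    apply: le_trans (settle_le d_gt0 lambda_gt0 M e0) _.
    rewrite /y -(addrA A) (expRD A) (expRD (c1 *+ _)); apply: ler_pM => //.
      by rewrite mulr_ge0// exprn_ge0 ?expR_ge0// mulr_ge0// ltW.
    by rewrite !expR_mulrn lnK ?posrE ?mulr_gt0// /c1.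
  have -> : expR (s * (A + c1 *+ n ^ d)) * z ^+ npart a = expR (s * y).
    by rewrite /z -expR_mulrn -expRD -mulrnAr -mulrDr.
  apply: le_trans (_ : Num.min 1 (expR y) + eps <= _); last by rewrite lerD2r min1_expR_le.
  rewrite -lerBlDr le_min; apply/andP; split.
    by rewrite lerBlDr ge_min lerDl eps0.
  by rewrite lerBlDr ge_min lerD2r yle orbT.
rewrite sumEFin lee_fin; under eq_bigr do rewrite mulrDr mulrCA.
rewrite big_split/= -mulr_sumr -mulr_suml expRB.
have z0 : 0 <= z by exact: expR_ge0.
apply: lerD.
  rewrite -expRN ler_wpM2l ?expR_ge0//.
  apply: le_trans (poisson_generating mu_gt0 z0 ur) _.
  by rewrite -expR_mulrn mulNrn.
rewrite ler_piMl//.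
have := poisson_generating mu_gt0 (ler01 : 0 <= 1 :> R) ur.
rewrite subrr mulr0 oppr0 expR0 expr1n.
by under eq_bigr do rewrite expr1n mulr1.
Qed.

(** With more particles than sites, the process is never stable. The factor
    [1/2] spares a passage to the limit in the number [M] of topplings. *)
Lemma fixed_lt1 t (a : config d n) : 0 <= t -> (n ^ d < npart a)%N ->
  (P (fixed_at X t) <= (1 - arw_initial_law mu a / 2)%:E)%E.
Proof.
move=> t0 big; pose K : R := (n ^ d)%:R * (1 + lambda) * t.
have K0 : 0 <= K by rewrite !mulr_ge0// addr_ge0// ltW.
pose M := (Num.truncn (2 * K)).+1.
have KM : 2 * K < M%:R by exact: truncnS_gt.
have := fixed_from_le d_gt0 lambda_gt0 HX a (isT : (0 < M)%N) t0.
rewrite settle_gt_volume// add0r => h.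
have ma := mp_measurable HX a (lexx 0).
have mf := measurable_fixed_at HX t0.
have [p tf law] := mp_law HX.
have Pa := law_init law a.
have {}h : (P (fixed_at X t `&` [set w | X 0 w = a]) <= (arw_initial_law mu a / 2)%:E)%E.
  rewrite setIC; apply: le_trans h _; rewrite lee_fin ler_wpM2l ?arw_initial_law_ge0//.
  rewrite ge_min; apply/orP; right; rewrite mulrAC -/K ler_pdivrMr//.
  by move: KM; lra.
have PDI := measureDI P mf ma.
have : (P (fixed_at X t `\` [set w | X 0 w = a]) <= (1 - arw_initial_law mu a)%:E)%E.
  rewrite EFinB -Pa -probability_setC//; apply: le_measure; rewrite ?inE.
  - exact: measurableD.
  - exact: measurableC.
  - by move=> w [].
move=> h'; apply: le_trans (_ : (_ + _ <= _))%E; first by rewrite PDI.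
apply: le_trans (leeD h' h) _.
by rewrite -EFinD lee_fin; lra.
Qed.

End Fixed.

(** * The choice of the constants *)

Section Constants.
Context {R : realType}.

Lemma expR_le_quadratic (x : R) : x <= 0 -> expR x <= 1 + x + x ^+ 2.
Proof.
move=> x0; rewrite -[x in expR x]opprK expRN invf_ple ?posrE ?expR_gt0//; last first.
  by have := sqr_ge0 (x + 2^-1); rewrite sqrrD; lra.
apply: le_trans (expR_ge1Dx _); rewrite -[leLHS]mul1r ler_pdivrMr; last first.
  by have := sqr_ge0 (x + 2^-1); rewrite sqrrD; lra.
have : 0 <= (- x) ^+ 3 by rewrite exprn_ge0// oppr_ge0.
by rewrite !exprS expr0 !mulr1; lra.
Qed.

(** The exponential rate of the bound of [fixed_le], where
    [c1 + mu * l < 0] is the condition on the parameters for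
    [l = ln (2 * lambda)], and [A] is taken equal to [3 * c0 * V + 2]. *)
Lemma fixation_rate (c1 mu l : R) : 0 < mu -> mu < 1 -> l < 0 -> c1 + mu * l < 0 ->
  exists c0 s : R, [/\ 0 < c0, 0 <= s <= 1 & forall V : R, 0 <= V ->
    s * (3 * c0 * V + 2 + c1 * V) - mu * (1 - expR (s * l)) * V <= 2 - 2 * c0 * V].
Proof.
move=> mu0 mu1 l0; rewrite -oppr_gt0; set D := - _ => D0.
pose s := D / (4 * l ^+ 2 + D); have l2 : 0 <= l ^+ 2 by exact: sqr_ge0.
have den : 0 < 4 * l ^+ 2 + D by rewrite ltr_wpDl// mulr_ge0.
have s0 : 0 < s by rewrite divr_gt0.
have s1 : s <= 1 by rewrite ler_pdivrMr// mul1r lerDr mulr_ge0.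
have sl : s * (4 * l ^+ 2) <= D.
  rewrite /s mulrAC ler_pdivrMr//; apply: ler_wpM2l; first exact: ltW.
  by rewrite lerDl ltW.
exists (s * D / 12), s; split; first by rewrite divr_gt0// mulr_gt0.
  by rewrite s1 ltW.
move=> V V0; have q := expR_le_quadratic (mulr_ge0_le0 (ltW s0) (ltW l0)).
have sD : 0 <= s * D by rewrite mulr_ge0 ?(ltW s0) ?(ltW D0).
have mus : mu * (s * (s * l ^+ 2)) <= s * (D / 4).
  rewrite -[leRHS]mul1r; apply: ler_pM; rewrite ?(ltW mu0) ?(ltW mu1)//.
    by apply: mulr_ge0; [exact: ltW|apply: mulr_ge0 => //; exact: ltW].
  by rewrite ler_wpM2l ?(ltW s0)//; move: sl; lra.
have mue : mu * (expR (s * l) - 1) <= mu * (s * l) + mu * (s * (s * l ^+ 2)).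
  by rewrite -mulrDr ler_wpM2l ?(ltW mu0)//; move: q; rewrite exprMn expr2; lra.
have ssD : s * (s * D) <= s * D by rewrite ler_piMl.
have : (s * (3 * (s * D / 12) + c1) - mu * (1 - expR (s * l))) * V <= (- 2 * (s * D / 12)) * V.
  rewrite ler_wpM2r//; have DE : D = - (c1 + mu * l) by [].
  have sDE : s * D = - (s * c1) - mu * (s * l) by rewrite DE; ring.
  move: mus mue ssD sDE sD; clear.
  move: (expR _) (mu * (s * (s * l ^+ 2))) => e u; lra.
move: (expR _) s1 V0 => e; clear; lra.
Qed.

End Constants.

Theorem theorem3 (R : realType) (d : nat) (hd : (1 <= d)%N) :
  exists2 kappa : R, 0 < kappa &
  forall mu lambda : R, 0 < mu -> mu < 1 -> 0 < lambda ->
    kappa * (2 * d%:R * lambda) `^ mu < mu `^ mu * (1 - mu) `^ (1 - mu) ->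
    exists2 c : R, 0 < c &
    forall n : nat, (1 <= n)%N ->
    forall (dO : measure_display) (Omega : measurableType dO)
      (P : probability Omega R) (X : R -> Omega -> config d n),
      arw mu lambda P X ->
      (P [set w | fixation_time X w < (expR (c * n%:R ^+ d))%:E]
       < (expR (- (c * n%:R ^+ d)))%:E)%E.
Proof.
pose c1 : R := 2 * @merge_cost R d + 1.
exists (expR c1); first exact: expR_gt0.
move=> mu lambda mu0 mu1 lambda0 cond; pose l := ln (2 * lambda).
have d1 : 1 <= d%:R :> R by rewrite ler1n.
have l2 : 0 < 2 * lambda by rewrite mulr_gt0.
have c1_ge0 : 0 <= c1.
  by rewrite /c1 /merge_cost !(addr_ge0, mulr_ge0)// ?exprn_ge0.
have rate : c1 + mu * l < 0.
  have dl : 2 * lambda <= 2 * d%:R * lambda by rewrite ler_pM2r// ler_peMr.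
  have ldl : l <= ln (2 * d%:R * lambda) by rewrite ler_ln ?posrE// (lt_le_trans l2).
  apply: le_lt_trans (_ : c1 + mu * ln (2 * d%:R * lambda) < 0).
    by rewrite lerD2l ler_pM2l.
  rewrite -expR_lt1 expRD; move: cond.
  rewrite {1}/powR gt_eqF ?(lt_le_trans l2)// => /lt_le_trans; apply.
  have pow_le1 (u : R) : 0 < u -> u <= 1 -> u `^ u <= 1.
    move=> u0 u1; rewrite /powR gt_eqF// -[leRHS]expR0 ler_expR.
    by rewrite mulr_ge0_le0 ?(ltW u0)// ln_le0.
  rewrite mulr_ile1 ?powR_ge0// pow_le1 ?subr_gt0 ?gerBl//; exact: ltW.
have l0 : l < 0.
  by rewrite -(pmulr_rlt0 _ mu0); apply: le_lt_trans rate; rewrite lerDr.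
have [c0 [s [c00 s01 exponent]]] := fixation_rate mu0 mu1 l0 rate.
(* Above the volume [V0], the bound of [fixed_le] is less than [exp (- c0 * V)]. *)
pose V0 := (Num.truncn (2 * (expR 2 + 1 + lambda) / c0 ^+ 2)).+1.
have V0P : 2 * (expR 2 + 1 + lambda) / c0 ^+ 2 < V0%:R by exact: truncnS_gt.
(* Below, [2 * w] is a lower bound on the probability that [V + 1] particles
   start from one given site and none from the others. *)
pose w := mu ^+ V0.+1 / V0.+1`!%:R * expR (- mu) ^+ V0 / 2.
have w0 : 0 < w.
  have f0 : 0 < (V0.+1`!)%:R :> R by rewrite ltr0n fact_gt0.
  apply: divr_gt0 => //; apply: mulr_gt0; last by rewrite exprn_gt0 ?expR_gt0.
  by apply: divr_gt0 => //; rewrite exprn_gt0.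
pose c := Num.min c0 (w / V0%:R / 2).
have V0R : 0 < V0%:R :> R by rewrite ltr0n.
have c_gt0 : 0 < c.
  by rewrite lt_min c00; apply: divr_gt0 => //; exact: divr_gt0.
exists c => // n n0 dO Omega P X HX.
have VE : n%:R ^+ d = (n ^ d)%:R :> R by rewrite natrX.
rewrite VE; set V := (n ^ d)%N; have V_gt0 : (0 < V)%N by rewrite expn_gt0 n0.
have V1 : 1 <= V%:R :> R by rewrite ler1n.
have cV0 : 0 <= c * V%:R by rewrite mulr_ge0// ltW.
have tau0 : 0 <= expR (c * V%:R) by exact: expR_ge0.
apply: le_lt_trans (fixation_le_fixed hd lambda0 HX tau0) _.
have [large|small] := leqP V0 V.
  pose M := (Num.truncn (expR (3 * c0 * V%:R))).+1.
  have ML : expR (3 * c0 * V%:R) < M%:R by exact: truncnS_gt.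
  have MU : M.+1%:R <= expR (3 * c0 * V%:R + 2).
    have e1 : 1 <= expR (3 * c0 * V%:R) by rewrite -expR0 ler_expR !mulr_ge0// ltW.
    have : M%:R <= expR (3 * c0 * V%:R) + 1.
      by rewrite /M -[(_.+1)%:R]natr1 lerD2r truncn_le// expR_ge0.
    have e2 : 3 <= expR 2 :> R.
      by apply: le_trans (expR_ge1Dx 2); lra.
    rewrite expRD -[M.+1%:R]natr1 => MU; apply: le_trans (_ : expR (3 * c0 * V%:R) * 3 <= _).
      by move: MU e1; lra.
    by rewrite ler_wpM2l ?expR_ge0.
  apply: le_lt_trans (fixed_le hd lambda0 mu0 HX (isT : (0 < M)%N) tau0 s01 MU) _.
  rewrite lte_fin -/V -/c1 -/l.
  have cc0 : c <= c0 by rewrite ge_min lexx.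
  apply: le_lt_trans (_ : (expR 2 + V%:R * (1 + lambda)) * expR (- (2 * c0 * V%:R)) < _).
    rewrite [leRHS]mulrDl; apply: lerD.
      rewrite -expRD ler_expR.
      by have := exponent V%:R (ler0n _ _); rewrite !mulr_natr.
    rewrite -!mulrA ler_wpM2l// ler_wpM2l ?addr_ge0 ?(ltW lambda0)//.
    rewrite mulrC ler_pdivrMr ?ltr0n// (mulrA 2).
    apply: le_trans (_ : expR (- (2 * c0 * V%:R)) * expR (3 * c0 * V%:R) <= _).
      rewrite -expRD ler_expR.
      have : c * V%:R <= c0 * V%:R by rewrite ler_wpM2r.
      by lra.
    by rewrite ler_wpM2l ?expR_ge0// ltW.
  apply: lt_le_trans (_ : expR (- (c0 * V%:R)) <= _); last first.
    by rewrite ler_expR lerN2 ler_wpM2r.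
  have -> : - (c0 * V%:R) = c0 * V%:R + - (2 * c0 * V%:R) by ring.
  rewrite [ltRHS]expRD ltr_pM2r ?expR_gt0//.
  have cV : 0 <= c0 * V%:R by rewrite mulr_ge0// ltW.
  apply: lt_le_trans (expR_ge1Dxn 1 cV); rewrite -[ltLHS]add0r ltr_leD//.
  rewrite (_ : 2`! = 2%N)// ler_pdivlMr// exprMn expr2 mulrA.
  apply: le_trans (_ : 2 * (expR 2 + 1 + lambda) * V%:R <= _).
    have : expR 2 <= expR 2 * V%:R :> R by rewrite ler_peMr// expR_ge0.
    by lra.
  rewrite ler_wpM2r ?ler0n//; move: V0P; rewrite ltr_pdivrMr ?exprn_gt0// => /ltW h.
  apply: (le_trans h); rewrite mulrC -expr2 ler_wpM2l ?ler_nat//.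
  by rewrite exprn_ge0// ltW.
pose x0 : torus d n := [ffun=> Ordinal n0].
pose a : config d n := [ffun x => Some (if x == x0 then V.+1 else 0%N)].
have aN : npart a = V.+1.
  rewrite /npart (bigD1 x0)//= ffunE eqxx big1 ?addn0// => x /negPf xx0.
  by rewrite ffunE xx0.
have law_a : 2 * w <= arw_initial_law mu a.
  rewrite /arw_initial_law (bigD1 x0)//= ffunE eqxx.
  rewrite (eq_bigr (fun=> expR (- mu))); last first.
    move=> x /negPf xx0; rewrite ffunE xx0 /poisson_pmf mu0 expr0 fact0.
    by rewrite invr1 !mul1r.
  have w2 : 2 * w = mu ^+ V0.+1 / V0.+1`!%:R * expR (- mu) ^+ V0.
    by rewrite /w mulrC divfK.
  rewrite prodr_const (_ : #|_| = V.-1); last first.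
    by rewrite /V -card_torus -(cardC1 x0); apply: eq_card => x.
  rewrite w2 /poisson_pmf mu0 -[leRHS]mulrA -exprS prednK//.
  have e1 : expR (- mu) <= 1 by rewrite -expR0 ler_expR oppr_le0 ltW.
  apply: ler_pM.
  - by rewrite divr_ge0// exprn_ge0// ltW.
  - by rewrite exprn_ge0// expR_ge0.
  - apply: ler_pM.
    + by rewrite exprn_ge0// ltW.
    + by rewrite invr_ge0.
    + apply: ler_wiXn2l; [exact: ltW|exact: ltW|by rewrite ltnS ltnW].
    + rewrite lef_pV2 ?posrE ?ltr0n ?fact_gt0// ler_nat.
      by apply: leq_fact; rewrite ltnS ltnW.
  - by apply: ler_wiXn2l; [exact: expR_ge0|exact: e1|exact: ltnW].
have aV : (n ^ d < npart a)%N by rewrite aN.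
apply: le_lt_trans (fixed_lt1 hd lambda0 HX tau0 aV) _.
rewrite lte_fin; apply: lt_le_trans (expR_ge1Dx _).
rewrite ltrD2l ltrN2.
apply: le_lt_trans (_ : w / V0%:R / 2 * V0%:R < _).
  apply: ler_pM; rewrite ?(ltW c_gt0)//; first by rewrite ge_min lexx orbT.
  by rewrite ler_nat ltnW.
have -> : w / V0%:R / 2 * V0%:R = w / 2 by field; rewrite gt_eqF.
by move: law_a w0; clear; move: (arw_initial_law _ _) w => u v; lra.
Qed.
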